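(* Let $P>0$, $\Omega_0,\Omega_1,\Omega_2>0$, and let $h_0,h_1,h_2$ be independent with $h_i\sim\mathcal{CN}(0,\Omega_i)$; set $\gamma_i=P|h_i|^2$ and $\bar\gamma_i=\mathbb E\gamma_i=P\Omega_i$. For $N\in\{T_1,T_2,R\}$ let $\Gamma_N=\sum_{k=1}^{L_N}P_{I,N}|c_{N,k}|^2$ with $L_N\ge1$, $P_{I,N}>0$, $c_{N,k}\sim\mathcal{CN}(0,\Omega_{N,k})$, $\Omega_{N,k}>0$, all of $h_0,h_1,h_2,c_{N,k}$ mutually independent. Let $\Gamma'_N=\mathbb E(\Gamma_N)$ and $\Gamma''_N=\mathbb E(\Gamma_N^2)$. Let $\omega_1,\omega_2\in(0,1)$ with $\omega_1+\omega_2=1$. For $i\in\{1,2\}$ and $j\in\{1,2\}\setminus\{i\}$ define $$\Upsilon_{T_i,D}=\frac{\gamma_0}{\Gamma_{T_i}+1},\quad \Upsilon_{T_i,1}=\frac{\gamma_i}{\Gamma_{T_i}+1},\quad \Upsilon_{T_i,2}=\frac{\omega_j\gamma_j}{\Gamma_R+\omega_i\Gamma_{T_i}+\omega_i+1},\quad \Upsilon_{T_i}=\Upsilon_{T_i,D}+\frac{\Upsilon_{T_i,1}\Upsilon_{T_i,2}}{\Upsilon_{T_i,1}+\Upsilon_{T_i,2}},$$ let $P^{\mathcal O}_{T_i}(\gamma)=\Pr(\Upsilon_{T_i}<\gamma)$ and define the protocol outage probability $P^{\mathcal O}_{\rm pro}(\gamma)=P^{\mathcal O}_{T_1}(\gamma)+P^{\mathcal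 O}_{T_2}(\gamma)-P^{\mathcal O}_{T_1}(\gamma)P^{\mathcal O}_{T_2}(\gamma)$. Then, as $\gamma_{th}\to0^+$, $$P^{\mathcal O}_{\rm pro}(\gamma_{th})=\sum_{i=1}^{2}\frac{\gamma_{th}^2}{2\bar\gamma_0}\left(\frac{\omega_i\left(\Gamma''_{T_i}+2\Gamma'_{T_i}+1\right)+\left(\Gamma'_R+1\right)\left(\Gamma'_{T_i}+1\right)}{\omega_j\bar\gamma_j}+\frac{\Gamma''_{T_i}+2\Gamma'_{T_i}+1}{\bar\gamma_i}\right)+o(\gamma_{th}^2),$$ where in the $i$-th summand $j$ denotes the element of $\{1,2\}\setminus\{i\}$.
   Context: Model of a three-phase amplify-and-forward two-way relay network with terminals $T_1,T_2$, relay $R$ and co-channel interference: $h_0,h_1,h_2$ are the $T_1$–$T_2$, $T_1$–$R$, $T_2$–$R$ channels, $P$ the common transmit power, $\Gamma_N$ the total interference power at node $N$, $\omega_i$ the relay power-allocation coefficients, and $\Upsilon_{T_i}$ the received SINR at terminal $T_i$. $o(\gamma_{th}^2)$ denotes a quantity whose ratio to $\gamma_{th}^2$ tends to $0$. *)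

(* Defs.v *)
From HB Require Import structures.
From mathcomp Require Import all_boot all_order all_algebra.
From mathcomp Require Import all_classical all_reals all_analysis.
Set Implicit Arguments. Unset Strict Implicit. Unset Printing Implicit Defensive.
Import Order.TTheory GRing.Theory Num.Theory.
Import numFieldNormedType.Exports.
Local Open Scope classical_set_scope.
Local Open Scope ring_scope.

Definition nT1 : 'I_3 := @Ordinal 3 0 isT.
Definition nT2 : 'I_3 := @Ordinal 3 1 isT.
Definition nR  : 'I_3 := @Ordinal 3 2 isT.
(* Channels h_0, h_1, h_2 are indexed by 'I_3 (h_0 : T1-T2, h_1 : T1-R,
   h_2 : T2-R). *)
Definition h0 : 'I_3 := @Ordinal 3 0 isT.
Definition h1 : 'I_3 := @Ordinal 3 1 isT.
Definition h2 : 'I_3 := @Ordinal 3 2 isT.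

(* Index of the real Gaussian components of all complex Gaussians:
   (inl i, b)      : real (b = false) / imaginary (b = true) part of h_i,
   (inr (N, k), b) : real / imaginary part of c_{N,k}. *)
Definition gidx := (('I_3 + ('I_3 * nat)) * bool)%type.

(* the components actually present in the model (k < L_N) *)
Definition relevant (L : 'I_3 -> nat) (j : gidx) : Prop :=
  match j.1 with inl _ => True | inr Nk => (Nk.2 < L Nk.1)%N end.

Section defs.
Context {R : realType} {d : measure_display} {T : measurableType d}
  (P : probability T R).

Definition mutually_independent (I : eqType) (S : set I)
  (X : I -> {RV P >-> R}) : Prop :=
  forall (s : seq I), uniq s -> (forall j, j \in s -> S j) ->
  forall B : I -> set R, (forall j, measurable (B j)) ->
  P (\bigcap_(j in [set j | j \in s]) (X j @^-1` B j)) =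
  (\prod_(j <- s) P (X j @^-1` B j))%E.

Definition is_normal0 (X : {RV P >-> R}) (v : R) : Prop :=
  forall A : set R, measurable A ->
    distribution P X A = normal_prob 0 (Num.sqrt v) A.

(* a complex random variable given by its real and imaginary parts
   (re, im) is CN(0, Om) : re, im i.i.d. N(0, Om/2) (independence is
   imposed globally, see the theorem) *)
Definition is_CN0 (re im : {RV P >-> R}) (Om : R) : Prop :=
  is_normal0 re (Om / 2) /\ is_normal0 im (Om / 2).

Variable Z : gidx -> {RV P >-> R}.

Definition habs2 (i : 'I_3) (t : T) : R :=
  Z (inl i, false) t ^+ 2 + Z (inl i, true) t ^+ 2.
Definition cabs2 (N : 'I_3) (k : nat) (t : T) : R :=
  Z (inr (N, k), false) t ^+ 2 + Z (inr (N, k), true) t ^+ 2.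

Definition gam (Pw : R) (i : 'I_3) (t : T) : R := Pw * habs2 i t.

Definition Gam (L : 'I_3 -> nat) (PI : 'I_3 -> R) (N : 'I_3) (t : T) : R :=
  \sum_(k < L N) PI N * cabs2 N k t.

Definition Expect (f : T -> R) : R := fine (\int[P]_t (f t)%:E)%E.

Definition Prob_lt (f : T -> R) (g : R) : R := fine (P [set t | f t < g]).

End defs.

Definition UpsD {R : realType} (g0 GTi : R) := g0 / (GTi + 1).
Definition Ups1 {R : realType} (gi GTi : R) := gi / (GTi + 1).
Definition Ups2 {R : realType} (gj GTi GR wi wj : R) :=
  wj * gj / (GR + wi * GTi + wi + 1).
Definition Ups {R : realType} (g0 gi gj GTi GR wi wj : R) : R :=
  UpsD g0 GTi +
  Ups1 gi GTi * Ups2 gj GTi GR wi wj / (Ups1 gi GTi + Ups2 gj GTi GR wi wj).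

Definition Ppro {R : realType} (p1 p2 : R) : R := p1 + p2 - p1 * p2.

Definition asym_term {R : realType} (g gb0 gbi gbj wi wj G1Ti G2Ti G1R : R) : R :=
  g ^+ 2 / (2 * gb0) *
  ((wi * (G2Ti + 2 * G1Ti + 1) + (G1R + 1) * (G1Ti + 1)) / (wj * gbj)
   + (G2Ti + 2 * G1Ti + 1) / gbi).

(* Main.v *)
(** Write D = gamma_0 / (Gamma_Ti + 1), X = Upsilon_{Ti,1}, Y = Upsilon_{Ti,2}, and
    let p(g) be the probability that D + XY/(X+Y) < g.
    Since XY/(X+Y) is at most min(X,Y), and is close to it unless X and Y are
    comparable, for every e > 0 and K = (1+e)/e the event lies between
      {X < g-D} \/ {Y < g-D}   and
      {X < (1+e)(g-D)} \/ {Y < (1+e)(g-D)} \/ {D < g, X < Kg, Y < Kg}.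
    Of the law of gamma_k one only needs x/m - (x/m)^2 <= Pr(gamma_k < x) <= x/m,
    which follows from bounding a planar Gaussian density on a disk.
    Integrating out gamma_1 or gamma_2 first, gamma_0 next and the interference
    last, the two single-channel events contribute the main term, of order g^2,
    and the triple intersections and all the corrections are O(g^3), with
    constants controlled by third moments of the interference powers.
    Hence |p(g) - c g^2| <= e c g^2 + O_e(g^3) for every e > 0.  *)

Require Import Defs.
From HB Require Import structures.
From mathcomp Require Import all_boot all_order all_algebra.
From mathcomp Require Import ring lra.
From mathcomp Require Import all_classical all_reals all_analysis.
From mathcomp Require Import measurable_realfun.
Set Implicit Arguments. Unset Strict Implicit. Unset Printing Implicit Defensive.
Import Order.TTheory GRing.Theory Num.Theory.
Import numFieldNormedType.Exports.
Local Open Scope classical_set_scope.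
Local Open Scope ring_scope.

(** * Independence of generated sigma-algebras *)

(** The obstacle is that D, X and Y share the interference Gamma_Ti, so they are dependent. Each of
    them is therefore written as [U k / A k]: the numerators [U k] are channel gains, each
    independent of all the rest, while the denominators [A k] depend on interference only and may be
    correlated. A numerator is integrated out against an arbitrary nonnegative weight that is
    measurable for a sigma-algebra independent of it, so no joint law of the [A k] ever enters. This
    also explains the shape of the coefficient: integrating [U k] leaves A_k/m_k times the positive
    part of g - D, and integrating [U h0] turns that positive part into A_0 g^2/(2 m_0). Only the
    mixed moment E(A_k A_0) survives, with the factor 1/2 coming from the integral of x over [0, g].
    The constant K blows up as e tends to 0, but it only affects the g^3 term, so letting g tend to
    0 at fixed e suffices. Finally the product of the two terminal outage probabilities is of order
    g^4 and disappears from the protocol outage. *)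

Lemma measurable_set_ltr {R : realType} d (T : measurableType d) (f g : T -> R) :
  measurable_fun setT f -> measurable_fun setT g ->
  measurable [set t | f t < g t].
Proof.
move=> mf mg; rewrite -[X in measurable X]setTI.
rewrite (_ : [set t | _] = (fun t => f t < g t) @^-1` [set true]).
  exact: measurable_fun_ltr.
by apply/seteqP; split.
Qed.

Section independence.
Context {R : realType} {d : measure_display} {T : measurableType d}.
Context (P : probability T R) (I : eqType) (S : set I) (X : I -> {RV P >-> R}).
Hypothesis indX : mutually_independent S X.
Implicit Type s : seq I.

(** A pi-system generating the sigma-algebra of the variables listed in [s]. Its members are exactly
    the events about which [mutually_independent] speaks. *)
Definition cylinders s : set (set T) :=
  [set A | exists2 B : I -> set R, (forall j, measurable (B j)) &
           A = \bigcap_(j in [set j | j \in s]) (X j @^-1` B j)].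

Lemma cylinders_measurable s : cylinders s `<=` measurable.
Proof.
move=> _ [B mB ->]; apply: fin_bigcap_measurable => // j _.
by rewrite -[_ @^-1` _]setTI; exact: measurable_funP.
Qed.

Lemma cylinders_setI s : setI_closed (cylinders s).
Proof.
move=> _ _ [B mB ->] [C mC ->].
exists (fun j => B j `&` C j) => [j|]; first exact: measurableI.
by rewrite -bigcapI; apply: eq_bigcapr => j _; rewrite preimage_setI.
Qed.

Lemma cylindersT s : cylinders s setT.
Proof.
exists (fun=> setT) => //.
by rewrite [RHS](_ : _ = setT)// -subTset => t _ j _.
Qed.

Lemma cylinders_preimage s j (B : set R) : j \in s -> measurable B ->
  cylinders s (X j @^-1` B).
Proof.
move=> js mB; exists (fun k => if k == j then B else setT).
  by move=> k; case: ifP.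
apply/seteqP; split => [t Bt k _ /=|t /(_ j)]; last by rewrite eqxx; apply.
by case: eqP => // ->.
Qed.

Variables s1 s2 : seq I.
Hypothesis us12 : uniq (s1 ++ s2).
Hypothesis s12S : forall j, j \in s1 ++ s2 -> S j.

(** As [s1] and [s2] are disjoint, the two families of Borel sets glue into one family over
    [s1 ++ s2], and the product formula for that family splits. *)
Lemma indep_cylinders A B : cylinders s1 A -> cylinders s2 B ->
  P (A `&` B) = (P A * P B)%E.
Proof.
move=> [A' mA ->] [B' mB ->].
move: (us12); rewrite cat_uniq => /and3P[us1 /hasPn s1s2 us2].
pose C j := if j \in s1 then A' j else B' j.
have mC j : measurable (C j) by rewrite /C; case: ifP.
have C1 j : j \in s1 -> C j = A' j by rewrite /C => ->.
have C2 j : j \in s2 -> C j = B' j by move=> /s1s2; rewrite /C => /negbTE ->.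
rewrite (indX us1 _ mA); last by move=> j js; apply: s12S; rewrite mem_cat js.
rewrite (indX us2 _ mB); last by move=> j js; apply: s12S; rewrite mem_cat js orbT.
have := indX us12 s12S mC; rewrite big_cat/=.
rewrite (eq_big_seq (fun j => P (X j @^-1` A' j))); last by move=> j /C1 ->.
rewrite [X in (_ * X)%E](eq_big_seq (fun j => P (X j @^-1` B' j))); last first.
  by move=> j /C2 ->.
move=> <-; congr (P _); apply/seteqP; split => [t [At Bt] j /=|t Ct].
  by rewrite mem_cat /C; case: ifPn => [/At//|_ /= /Bt].
split=> j /= js; have := Ct j; rewrite /= mem_cat js ?orbT => /(_ isT).
  by rewrite C1.
by rewrite C2.
Qed.

(** Uniqueness of measures on a pi-system: for fixed [C], both D -> P(D n C) and D -> P(C) P(D) are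
    finite measures, so agreement on cylinders extends to the generated sigma-algebra. *)
Lemma indep_sigma A B : <<s cylinders s1 >> A -> <<s cylinders s2 >> B ->
  P (A `&` B) = (P A * P B)%E.
Proof.
have sm s C : <<s cylinders s >> C -> measurable C.
  by move: C; apply: smallest_sub (@cylinders_measurable s); exact: sigma_algebra_measurable.
have PE C : measurable C -> P C = (fine (P C))%:E.
  by move=> mC; rewrite fineK// fin_num_measure.
pose nn C := NngNum (fine_ge0 (measure_ge0 P C)).
have step s (C : set T) (mC : measurable C) :
    (forall D, cylinders s D -> P (D `&` C) = (P D * P C)%E) ->
    forall D, <<s cylinders s >> D -> P (D `&` C) = (P D * P C)%E.
  move=> H D sD.
  rewrite muleC [in RHS](PE C)//.
  apply: (@g_sigma_algebra_measure_unique _ _ _ (cylinders s)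
    (@cylinders_measurable s) (fun=> setT) _ _
    (mrestr P mC) (mscale (nn C) P)) => //.
  - by move=> _; exact: cylindersT.
  - exact: bigcup_const.
  - exact: cylinders_setI.
  - move=> E sE; transitivity (P (E `&` C)) => //; rewrite H// muleC PE//.
  - move=> _; apply: (@le_lt_trans _ _ (P setT)); last by rewrite probability_setT ltry.
    by apply: le_measure; rewrite ?inE//; exact: measurableI.
(* The extension is made twice: over [s1] with [B] fixed, and, to get its premise on cylinders, over
   [s2] with a cylinder of [s1] fixed. *)
move=> sA sB.
apply: (step s1) => //; first exact: sm sB.
move=> D cD; rewrite setIC muleC; apply: (step s2) => //.
  exact: cylinders_measurable cD.
by move=> E cE; rewrite setIC muleC indep_cylinders.
Qed.

End independence.

(** * Integrating out a variable independent of a sigma-algebra *)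

Section independence_from_a_sigma_algebra.
Context {R : realType} {d : measure_display} {T : measurableType d}.
Context (P : probability T R).

(** The second side is a sigma-algebra rather than a variable, so that any function of the remaining
    channels and interference powers can serve as a weight once it is measurable for it. *)
Definition indep_from (U : T -> R) (G : set (set T)) :=
  forall (A : set R) (B : set T), measurable A -> <<s G>> B ->
    P (U @^-1` A `&` B) = (P (U @^-1` A) * P B)%E.

Lemma measurable_sub_sigma (G : set (set T)) d' (T' : measurableType d')
    (V : T -> T') : G `<=` measurable ->
  measurable_fun [set: g_sigma_algebraType G] V -> measurable_fun [set: T] V.
Proof.
move=> Gm mV _ B mB; have : <<s G >> (setT `&` V @^-1` B) by exact: mV.
by apply: smallest_sub Gm _; exact: sigma_algebra_measurable.
Qed.

Local Open Scope ereal_scope.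

(** Independence makes the law of [(U, V)] a product measure, by uniqueness on rectangles; Tonelli
    then allows [V] to be frozen while [U] is integrated. *)
Lemma integral_indep (U : T -> R) (G : set (set T))
    d' (T' : measurableType d') (V : T -> T') (f : R * T' -> \bar R) :
  G `<=` measurable -> indep_from U G ->
  measurable_fun [set: T] U ->
  measurable_fun [set: g_sigma_algebraType G] V ->
  measurable_fun setT f -> (forall x, 0 <= f x) ->
  \int[P]_t f (U t, V t) = \int[P]_t \int[P]_t' f (U t', V t).
Proof.
move=> Gm UG mU mV mf f0.
have mV' := measurable_sub_sigma Gm mV.
pose U' := mfun_Sub (mem_set mU) : {mfun T >-> R}.
pose V' := mfun_Sub (mem_set mV') : {mfun T >-> T'}.
have mUV : measurable_fun [set: T] (fun t => (U t, V t)).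
  exact/measurable_fun_pairP.
pose UV' := mfun_Sub (mem_set mUV) : {mfun T >-> (R * T')%type}.
pose mu := distribution P U'; pose nu := distribution P V'.
transitivity (\int[mu \x nu]_z f z).
  transitivity (\int[distribution P UV']_z f z).
    by rewrite ge0_integral_distribution.
  apply: eq_measure_integral => A mA _.
  apply/esym; apply: product_measure_unique => // B C mB mC.
  rewrite /= /mu /nu /distribution /pushforward/=.
  rewrite -UG//.
  by rewrite -[X in <<s _ >> X]setTI; exact: mV.
rewrite fubini_tonelli2//; rewrite ge0_integral_distribution//.
- apply: eq_integral => t _; rewrite /= /fubini_G/=.
  by rewrite ge0_integral_distribution//; exact/measurableT_comp.
- exact: measurable_fun_fubini_tonelli_G.
- by move=> y; exact: integral_ge0.
Qed.

End independence_from_a_sigma_algebra.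

(** * Gaussian measure of small disks *)

Section normal.
Context {R : realType}.
Local Notation mu := (@lebesgue_measure R).

(** The change of variables yields a Radon-Nikodym derivative, which is determined only almost
    everywhere; it is identified with [normal_pdf] because both have the same integral over every
    measurable set. *)
Lemma ge0_integral_normal_prob (m s : R) (f : R -> \bar R) :
  measurable_fun setT f -> (forall x, (0 <= f x)%E) ->
  (\int[normal_prob m s]_x f x = \int[mu]_x (f x * (normal_pdf m s x)%:E))%E.
Proof.
move=> mf f0.
rewrite -(Radon_Nikodym_SigmaFinite.change_of_variables (normal_prob_dominates m s))//.
have dom := normal_prob_dominates m s.
apply: ae_eq_integral => //.
- apply: emeasurable_funM => //; apply: (measurable_int mu).
  exact: Radon_Nikodym_SigmaFinite.f_integrable.
- apply: emeasurable_funM => //=; apply/measurableT_comp => //=.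
  exact: measurable_normal_pdf.
- apply: ae_eqe_mul2l => /=.
  apply: integral_ae_eq => //=.
  + exact: Radon_Nikodym_SigmaFinite.f_integrable.
  + by apply/measurableT_comp => //; exact: measurable_normal_pdf.
  + by move=> E _ mE; rewrite -Radon_Nikodym_SigmaFinite.f_integral.
Qed.

Let is_derive_sqr_cos (x : R) :
  is_derive x 1 (fun y : R => (y + sin y * cos y) / 2) (cos x ^+ 2).
Proof.
have -> : (fun y : R => (y + sin y * cos y) / 2) = (2^-1 : R) \*: (id + sin * cos).
  by apply/funext => y; rewrite /= mulrC.
apply: is_derive_eq.
by rewrite /GRing.scale/= -[X in 2^-1 * (X + _)](cos2Dsin2 x); by field.
Qed.

Let integral_sqr_cos : (\int[mu]_(x in `[(- (pi / 2))%R, (pi / 2)%R])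
  (cos x ^+ 2)%:E = (pi / 2)%:E)%E.
Proof.
set F := fun y : R => (y + sin y * cos y) / 2.
have dF (x : R) : is_derive x 1 F (cos x ^+ 2) by exact: is_derive_sqr_cos.
rewrite (@continuous_FTC2 _ (fun x => cos x ^+ 2) F).
- by rewrite /F cosN sinN cos_pihalf !mulr0 !addr0 -EFinB; congr EFin; by field.
- by have := @pi_gt0 R; lra.
- by apply: continuous_subspaceT => x; apply: cvgM; exact: continuous_cos.
- have cF : continuous F.
    move=> x; apply: differentiable_continuous; apply/derivable1_diffP.
    exact: ex_derive.
  split; first by move=> x _; exact: ex_derive.
    by apply: cvg_at_right_filter; exact: cF.
  by apply: cvg_at_left_filter; exact: cF.
- by move=> x _; rewrite derive1E derive_val.
Qed.

(** The substitution x = r sin(theta) turns the integrand into r^2 cos^2(theta) on an interval where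
    the cosine is nonnegative. *)
Lemma integral_half_disk (r : R) : 0 < r ->
  (\int[mu]_(x in `[(- r)%R, r]) (Num.sqrt (r ^+ 2 - x ^+ 2))%:E =
   (pi * r ^+ 2 / 2)%:E)%E.
Proof.
move=> r0.
have p0 := @pi_gt0 R.
pose F (x : R) := r * sin x.
have dF (x : R) : is_derive x 1 F (r * cos x) by apply: is_derive_eq.
have F' : derive1 F = fun x => r * cos x.
  by apply/funext => x; rewrite derive1E derive_val.
have cF : continuous F.
  by move=> x; apply: cvgM; [exact: cvg_cst|exact: continuous_sin].
have cF' : continuous (fun x => r * cos x).
  by move=> x; apply: cvgM; [exact: cvg_cst|exact: continuous_cos].
have FN : - r = F (- (pi / 2)) by rewrite /F sinN sin_pihalf mulrN1.
have Fr : r = F (pi / 2) by rewrite /F sin_pihalf mulr1.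
rewrite [in Interval _ _]FN [in X in BRight X]Fr.
rewrite (@integration_by_substitution_increasing R F
  (fun x => Num.sqrt (r ^+ 2 - x ^+ 2)) (- (pi / 2)) (pi / 2)).
- rewrite F'.
  transitivity (\int[mu]_(x in `[(- (pi / 2))%R, (pi / 2)%R])
      ((r ^+ 2)%:E * (cos x ^+ 2)%:E))%E.
    apply: eq_integral => x; rewrite inE/= in_itv/= => xI.
    have cx : 0 <= cos x by rewrite cos_ge0_pihalf// in_itv.
    rewrite !fctE/= /F (_ : r ^+ 2 - _ = (r * cos x) ^+ 2); last first.
      by rewrite -[r ^+ 2]mulr1 -(cos2Dsin2 x); ring.
    rewrite sqrtr_sqr ger0_norm; last by rewrite mulr_ge0// ltW.
    by rewrite -EFinM -exprMn.
  rewrite ge0_integralZl//=.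
  + by rewrite integral_sqr_cos -EFinM; congr EFin; ring.
  + apply/measurable_EFinP/measurable_funX/measurable_funTS.
    apply: continuous_measurable_fun; exact: continuous_cos.
  + by move=> x _; rewrite lee_fin sqr_ge0.
  + by rewrite lee_fin sqr_ge0.
- by lra.
- move=> x y xI yI xy; by rewrite ltr_pM2l// ltr_sin.
- by move=> x _; rewrite F'; exact: cF'.
- by rewrite F'; apply/cvg_ex; exists (r * cos (- (pi / 2))); apply: cvg_at_right_filter; exact: cF'.
- by rewrite F'; apply/cvg_ex; exists (r * cos (pi / 2)); apply: cvg_at_left_filter; exact: cF'.
- split; first by move=> x _; exact: ex_derive.
    by apply: cvg_at_right_filter; exact: cF.
  by apply: cvg_at_left_filter; exact: cF.
- apply: continuous_subspaceT => x; apply: continuous_comp; last exact: sqrt_continuous.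
  by apply: cvgB; [exact: cvg_cst|exact: exprn_continuous].
Qed.

Lemma measurable_chord (y : R) :
  measurable_fun [set: R] (fun x => Num.sqrt (y - x ^+ 2)).
Proof.
apply: continuous_measurable_fun => x.
apply: continuous_comp; last exact: sqrt_continuous.
by apply: cvgB; [exact: cvg_cst|exact: exprn_continuous].
Qed.

(** [Num.sqrt] vanishes on negative numbers, so the integral over the whole line only sees the half
    disk of radius sqrt(y). *)
Lemma integral_disk (y : R) : 0 <= y ->
  (\int[mu]_x (Num.sqrt (y - x ^+ 2))%:E = (pi * y / 2)%:E)%E.
Proof.
rewrite le_eqVlt => /predU1P[<-|y0].
  rewrite mulr0 mul0r integral0_eq// => x _.
  by rewrite ler0_sqrtr// sub0r oppr_le0 sqr_ge0.
have r0 : 0 < Num.sqrt y by rewrite sqrtr_gt0.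
rewrite -{2}(sqr_sqrtr (ltW y0)) -integral_half_disk//.
rewrite [RHS]integral_mkcond/=; apply: eq_integral => x _.
rewrite patchE; case: ifPn; first by rewrite sqr_sqrtr// ltW.
move=> xr; rewrite ler0_sqrtr// subr_le0 leNgt; apply: contra xr => xy.
by rewrite inE/= in_itv/= -ler_norml -sqrtr_sqr ler_wsqrtr// ltW.
Qed.

Variable s : R.
Hypothesis s0 : 0 < s.

Let pdfE (x : R) : normal_pdf 0 s x = normal_peak s * expR (- (x ^+ 2 / (s ^+ 2 * 2))).
Proof. by rewrite normal_pdfE ?gt_eqF// /normal_fun subr0 mulr_natr mulNr. Qed.

Let peak2 : normal_peak s ^+ 2 = (2 * pi * s ^+ 2)^-1.
Proof.
rewrite /normal_peak exprVn sqr_sqrtr; first by congr (_^-1); rewrite -mulr_natr; ring.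
by rewrite mulrn_wge0// mulr_ge0 ?sqr_ge0// pi_ge0.
Qed.

Let chord (a y : R) : [set b : R | (a ^+ 2 + b ^+ 2 < y)%R] =
  `]- Num.sqrt (y - a ^+ 2), Num.sqrt (y - a ^+ 2)[%classic.
Proof.
apply/seteqP; split => b /=; rewrite in_itv/= -ltr_norml -sqrtr_sqr.
  move=> h; have h1 : b ^+ 2 < y - a ^+ 2 by lra.
  by rewrite ltr_sqrt// (le_lt_trans _ h1)// sqr_ge0.
move=> h; have h0 : 0 < y - a ^+ 2.
  by rewrite -sqrtr_gt0 (le_lt_trans _ h)// sqrtr_ge0.
by move: h; rewrite ltr_sqrt//; lra.
Qed.

(** On the disk of area pi y the planar density lies between [normal_peak s ^+ 2] times exp(-u) and
    [normal_peak s ^+ 2], and this square times pi y is exactly [u]. The lower bound then follows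
    from exp(-u) >= 1 - u. *)
Lemma normal_disk_bounds (y : R) : 0 <= y ->
  ((y / (2 * s ^+ 2) - (y / (2 * s ^+ 2)) ^+ 2)%:E <=
   \int[normal_prob 0 s]_a
     normal_prob 0 s [set b : R | ((a : R) ^+ 2 + b ^+ 2 < y)%R] <=
   (y / (2 * s ^+ 2))%:E)%E.
Proof.
move=> y0; set u := y / _.
have p0 := @pi_gt0 R.
have u0 : 0 <= u by rewrite divr_ge0// mulr_ge0// sqr_ge0.
pose q a := Num.sqrt (y - a ^+ 2).
have mq : measurable_fun setT q by exact: measurable_chord.
have q0 a : 0 <= q a by exact: sqrtr_ge0.
have chordm a : mu `]- q a, q a[%classic = (2 * q a)%:E.
  rewrite lebesgue_measure_itv/= lte_fin.
  have := q0 a; rewrite le_eqVlt => /predU1P[<-|qa].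
    by rewrite oppr0 ltxx mulr0.
  by rewrite ifT; [rewrite -EFinB; congr EFin; ring|lra].
have peak0 := normal_peak_ge0 s.
have fge0 a : (0 <= normal_prob 0 s [set b : R | (a ^+ 2 + b ^+ 2 < y)%R]
    * (normal_pdf 0 s a)%:E)%E.
  by rewrite mule_ge0// lee_fin normal_pdf_ge0.
have mpdf : measurable_fun setT (EFin \o normal_pdf 0 s).
  by apply/measurable_EFinP; exact: measurable_normal_pdf.
have intq k : 0 <= k ->
    (\int[mu]_a (k * (2 * q a))%:E = (k * (pi * y))%:E)%E.
  move=> k0; under eq_integral do rewrite mulrA EFinM.
  rewrite ge0_integralZl//=.
  - by rewrite integral_disk// -EFinM; congr EFin; field.
  - exact/measurable_EFinP.
  - by move=> a _; rewrite lee_fin.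
  - by rewrite lee_fin mulr_ge0.
have upper a : (normal_prob 0 s [set b : R | (a ^+ 2 + b ^+ 2 < y)%R]
    * (normal_pdf 0 s a)%:E <= (normal_peak s ^+ 2 * (2 * q a))%:E)%E.
  rewrite [X in (_ <= X%:E)%E](_ : _ =
    (normal_peak s * (2 * q a)) * normal_peak s); last by ring.
  rewrite [leRHS]EFinM.
  apply: lee_pmul => //; rewrite ?lee_fin ?normal_pdf_ge0//; last first.
    by rewrite normal_pdf_ub// gt_eqF.
  rewrite chord /normal_prob EFinM -chordm -integral_cst//.
  apply: ge0_le_integral => //.
  - by move=> b _; rewrite lee_fin normal_pdf_ge0.
  - exact: measurable_funTS.
  - by move=> b _; rewrite lee_fin normal_pdf_ub// gt_eqF.
have lower a : ((normal_peak s ^+ 2 * expR (- u) * (2 * q a))%:E <=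
    normal_prob 0 s [set b : R | (a ^+ 2 + b ^+ 2 < y)%R] * (normal_pdf 0 s a)%:E)%E.
  (* [c] is the density at the ends of the chord above [a], its smallest value on that chord.
     Multiplied by the density at [a] it no longer depends on [a]: the exponents add up to -u. *)
  pose c := normal_peak s * expR (- ((y - a ^+ 2) / (s ^+ 2 * 2))).
  rewrite [leLHS](_ : _ = (c * (2 * q a))%:E * (normal_pdf 0 s a)%:E)%E.
    apply: lee_wpmul2r; first by rewrite lee_fin normal_pdf_ge0.
    rewrite chord /normal_prob EFinM -chordm -integral_cst//.
    apply: ge0_le_integral => //.
    - by move=> b _; rewrite lee_fin mulr_ge0// expR_ge0.
    - exact: measurable_funTS.
    - move=> b /=; rewrite in_itv/= -ltr_norml => bq.
      rewrite lee_fin pdfE ler_wpM2l// ler_expR lerN2 ler_pM2r; last first.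
        by rewrite invr_gt0 mulr_gt0// exprn_gt0.
      have : b ^+ 2 < q a ^+ 2 by rewrite -[b ^+ 2]real_normK ?num_real// ltr_pXn2r ?nnegrE.
      rewrite sqr_sqrtr; first by move/ltW.
      by apply: ltW; rewrite -sqrtr_gt0; exact: le_lt_trans bq.
  rewrite -EFinM pdfE; congr EFin.
  rewrite /c [RHS](_ : _ = normal_peak s ^+ 2 *
    (expR (- ((y - a ^+ 2) / (s ^+ 2 * 2))) *
     expR (- (a ^+ 2 / (s ^+ 2 * 2)))) * (2 * q a)); last by ring.
  rewrite -expRD; congr (_ * expR _ * _); rewrite /u; field.
  by rewrite gt_eqF.
have mf : measurable_fun setT (fun a : R =>
    normal_prob 0 s [set b : R | (a ^+ 2 + b ^+ 2 < y)%R]).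
  have mS : measurable [set z : R * R | z.1 ^+ 2 + z.2 ^+ 2 < y].
    apply: measurable_set_ltr => //.
    by apply: measurable_funD; apply: measurable_funX; [exact: measurable_fst|exact: measurable_snd].
  rewrite (_ : (fun a => _) = normal_prob 0 s \o
      xsection [set z : R * R | z.1 ^+ 2 + z.2 ^+ 2 < y]).
    exact: (@measurable_fun_xsection _ _ (measurableTypeR R) (measurableTypeR R)
      R (normal_prob 0 s) _ mS).
  apply/funext => a /=; congr normal_prob.
  by apply/seteqP; split => b; rewrite /xsection/= inE.
rewrite ge0_integral_normal_prob//.
have pE : normal_peak s ^+ 2 * (pi * y) = u.
  rewrite peak2 /u; move: (pi : R) p0 => p p0; field.
  by rewrite !gt_eqF.
have mint : measurable_fun setT (fun a : R => normal_prob 0 s [set b : R | (a ^+ 2 + b ^+ 2 < y)%R]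
    * (normal_pdf 0 s a)%:E)%E by exact: emeasurable_funM.
have mqk k : measurable_fun setT (fun a => (k * (2 * q a))%:E).
  by apply/measurable_EFinP; apply: measurable_funM => //; exact: measurable_funM.
apply/andP; split.
  apply: (@le_trans _ _ (\int[mu]_a (normal_peak s ^+ 2 * expR (- u) * (2 * q a))%:E)%E).
    rewrite intq; last by rewrite mulr_ge0 ?sqr_ge0 ?expR_ge0.
    rewrite mulrAC pE lee_fin -[u in u - _]mulr1 expr2 -mulrBr ler_wpM2l//.
    exact: expR_ge1Dx.
  apply: ge0_le_integral => //; last exact: mqk.
  by move=> a _; rewrite lee_fin !mulr_ge0 ?expR_ge0.
apply: (@le_trans _ _ (\int[mu]_a (normal_peak s ^+ 2 * (2 * q a))%:E)%E); last first.
  by rewrite intq ?sqr_ge0// pE.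
by apply: ge0_le_integral => //; exact: mqk.
Qed.

(** Half of the exponent absorbs the power through w^3/6 <= exp(w), where x^2 = 4 s^2 w; this gives
    384 = 4^3 * 6. The other half is a Gaussian of variance 2 s^2. *)
Let pow6_expR (x : R) :
  x ^+ 6 * expR (- (x ^+ 2 / (s ^+ 2 * 2))) <=
  384 * s ^+ 6 * expR (- (x ^+ 2 / (s ^+ 2 * 2 * 2))).
Proof.
set w := x ^+ 2 / (s ^+ 2 * 2 * 2).
have s2 : 0 < s ^+ 2 * 2 by rewrite mulr_gt0// exprn_gt0.
have w0 : 0 <= w by rewrite divr_ge0 ?sqr_ge0// ltW// mulr_gt0.
have x2 : x ^+ 2 = w * (s ^+ 2 * 2 * 2) by rewrite divfK// gt_eqF// mulr_gt0.
have -> : x ^+ 2 / (s ^+ 2 * 2) = w + w.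
  by rewrite /w; move: (s ^+ 2 * 2) => A; rewrite invfM mulrA -splitr.
rewrite opprD expRD mulrA; apply: ler_wpM2r; first exact: expR_ge0.
rewrite expRN ler_pdivrMr ?expR_gt0// (exprM x 2 3) x2.
have w3 : w ^+ 3 / 6 <= expR w.
  by have := expR_ge1Dxn 2 w0; rewrite (_ : 3`! = 6)%N//; lra.
rewrite (_ : (w * (s ^+ 2 * 2 * 2)) ^+ 3 = 384 * s ^+ 6 * (w ^+ 3 / 6)); last by field.
apply: ler_wpM2l w3; apply: mulr_ge0; [exact: ler0n|exact/exprn_ge0/ltW].
Qed.

(** Interference powers are sums of squared Gaussians, so their third moments require sixth Gaussian
    moments. The comparison is with a normal density of deviation s sqrt(2). *)
Lemma normal_moment6 : (\int[normal_prob 0 s]_x ((x : R) ^+ 6)%:E < +oo)%E.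
Proof.
have mX : measurable_fun setT (fun x : R => (x ^+ 6)%:E).
  by apply/measurable_EFinP; exact: exprn_measurable.
have X0 (x : R) : (0 <= (x ^+ 6)%:E)%E by rewrite lee_fin (exprM x 3 2) sqr_ge0.
rewrite ge0_integral_normal_prob//.
pose s' := s * Num.sqrt 2.
have s'0 : s' != 0 by rewrite gt_eqF// mulr_gt0.
have s'2 : s' ^+ 2 = s ^+ 2 * 2 by rewrite exprMn sqr_sqrtr.
pose c := normal_peak s / normal_peak s' * (384 * s ^+ 6).
have pk' : 0 < normal_peak s' by rewrite normal_peak_gt0.
have pk : 0 <= normal_peak s by exact: normal_peak_ge0.
have c0 : 0 <= c.
  apply: mulr_ge0; first by apply: divr_ge0 pk _; exact: ltW.
  by apply: mulr_ge0; [exact: ler0n|exact/exprn_ge0/ltW].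
have mp' : measurable_fun setT (EFin \o normal_pdf 0 s').
  by apply/measurable_EFinP; exact: measurable_normal_pdf.
apply: (@le_lt_trans _ _ (\int[mu]_x (c%:E * (normal_pdf 0 s' x)%:E))%E).
  apply: ge0_le_integral => //.
  - by move=> x _; rewrite mule_ge0// lee_fin normal_pdf_ge0.
  - apply: emeasurable_funM => //.
    by apply/measurable_EFinP; exact: measurable_normal_pdf.
  - exact: emeasurable_funM.
  - move=> x _; rewrite -!EFinM lee_fin pdfE normal_pdfE//.
    rewrite /normal_fun subr0 s'2 mulNr -(mulr_natr (s ^+ 2 * 2) 2).
    rewrite /c [leRHS]mulrACA divfK ?gt_eqF// [leLHS]mulrCA; apply: ler_wpM2l => //.
rewrite ge0_integralZl//=; first by rewrite integral_normal_pdf mule1 ltry.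
by move=> x _; rewrite lee_fin normal_pdf_ge0.
Qed.

End normal.

(** * Variables with a linear distribution function at the origin *)

Lemma measurable_ltr_nat {R : realType} d (T : measurableType d) (f g : T -> R) :
  measurable_fun setT f -> measurable_fun setT g ->
  measurable_fun setT (fun t => (f t < g t)%R%:R : R).
Proof.
move=> mf mg; rewrite [X in measurable_fun _ X](_ : _ =
  fun t => if f t < g t then 1 else 0); last by apply/funext => t; case: ifP.
by apply: measurable_fun_ifT => //; exact: measurable_fun_ltr.
Qed.

Lemma integral_ltr_nat {R : realType} d (T : measurableType d)
    (mu : {measure set T -> \bar R}) (f g : T -> R) :
  measurable_fun setT f -> measurable_fun setT g ->
  (\int[mu]_t ((f t < g t)%R%:R : R)%:E = mu [set t | (f t < g t)%R])%E.
Proof.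
move=> mf mg; have mfg := measurable_set_ltr mf mg.
rewrite -[X in mu X]setIT -(integral_indic mu measurableT mfg).
by apply: eq_integral => t _; rewrite indicE; congr ((nat_of_bool _)%:R%:E); apply/idP/idP; rewrite inE.
Qed.

Lemma integral_exprn {R : realType} (a : R) n : 0 <= a ->
  (\int[lebesgue_measure]_(x in `[0%R, a]) (x ^+ n)%:E = (a ^+ n.+1 / n.+1%:R)%:E)%E.
Proof.
rewrite le_eqVlt => /predU1P[<-|a0].
  by rewrite set_itv1 integral_set1 exprS mul0r mul0r.
pose F (x : R) := n.+1%:R^-1 * x ^+ n.+1.
have dF (x : R) : is_derive x 1 F (x ^+ n).
  have -> : F = (n.+1%:R^-1 : R) \*: (@id R ^+ n.+1).
    by apply/funext => y; rewrite /F !fctE.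
  apply: is_derive_eq; rewrite /GRing.scale/= mulr1.
  by rewrite mulrA mulVf ?mul1r// pnatr_eq0.
have cF : continuous F.
  by move=> x; apply: cvgM; [exact: cvg_cst|exact: exprn_continuous].
rewrite (@continuous_FTC2 _ (fun x => x ^+ n) F)//.
- by rewrite /F expr0n mulr0 sube0 mulrC.
- by apply: continuous_subspaceT => x; exact: exprn_continuous.
- split; first by move=> x _; exact: ex_derive.
    by apply: cvg_at_right_filter; exact: cF.
  by apply: cvg_at_left_filter; exact: cF.
- by move=> x _; rewrite derive1E derive_val.
Qed.

Section linear_cdf.
Context {R : realType} {d : measure_display} {T : measurableType d}.
Context (P : probability T R).
Local Open Scope ereal_scope.

(* The lower bound is stated without subtraction, so that it can be integrated
   as an inequality between nonnegative extended reals. *)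
Definition linear_cdf (U : T -> R) (m : R) := forall x : R, (0 <= x)%R ->
  (x / m)%:E <= P [set t | (U t < x)%R] + ((x / m) ^+ 2)%:E /\
  P [set t | (U t < x)%R] <= (x / m)%:E.

Context (U : T -> R) (m : R) (G : set (set T)).
Hypotheses (m0 : (0 < m)%R) (U0 : forall t, (0 <= U t)%R).
Hypotheses (mU : measurable_fun setT U) (Gm : G `<=` measurable).
Hypotheses (UG : indep_from P U G) (lU : linear_cdf U m).

(** Layer-cake formula: since [U] is nonnegative, the positive part of a - U is the integral over x
    in [0, a] of the indicator of U < x. Integrating the bounds x/m and (x/m)^2 gives the constants
    2m and 3m^2. *)
Lemma expect_pos_part (a : R) : (0 <= a)%R ->
  (a ^+ 2 / (2 * m))%:E <=
    \int[P]_t (Num.max 0 (a - U t))%:E + (a ^+ 3 / (3 * m ^+ 2))%:E /\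
  \int[P]_t (Num.max 0 (a - U t))%:E <= (a ^+ 2 / (2 * m))%:E.
Proof.
move=> a0.
have mU1 : measurable_fun setT (fun z : T * R => U z.1).
  exact: measurableT_comp.
pose f (z : T * R) : \bar R :=
  ((\1_(`[0%R, a]%classic : set R) z.2 : R) * (U z.1 < z.2)%R%:R)%:E.
have mf : measurable_fun setT f.
  apply/measurable_EFinP; apply: measurable_funM.
    by apply: measurableT_comp => //; exact: measurable_indic.
  exact: measurable_ltr_nat.
have f0 z : 0 <= f z by rewrite lee_fin mulr_ge0.
have mF : measurable_fun setT (fun x : R => P [set t | (U t < x)%R]).
  have mS : measurable [set z : T * R | (U z.1 < z.2)%R].
    exact: measurable_set_ltr.
  rewrite (_ : (fun x => _) = P \o ysection [set z : T * R | (U z.1 < z.2)%R]).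
    exact: measurable_fun_ysection.
  apply/funext => x /=; congr (P _).
  by apply/seteqP; split => t; rewrite /ysection/= inE.
have -> : \int[P]_t (Num.max 0 (a - U t))%:E =
    \int[lebesgue_measure]_(x in `[0%R, a]) P [set t | (U t < x)%R].
  transitivity (\int[P]_t \int[@lebesgue_measure R]_x f (t, x)).
    apply: eq_integral => t _; rewrite /f/=.
    rewrite [RHS](_ : _ = \int[lebesgue_measure]_x (\1_(`]U t, a]%classic : set R) x)%:E).
      rewrite integral_indic// setIT.
      rewrite -[RHS]/(lebesgue_measure (`]U t, a]%classic : set R)).
      rewrite lebesgue_measure_itv/= lte_fin.
      by case: ltP => h; rewrite -?EFinB; congr EFin; [rewrite max_r|rewrite max_l]; lra.
    apply: eq_integral => x _; rewrite !indicE -natrM mulnb; congr ((nat_of_bool _)%:R%:E).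
    rewrite !mem_setE !in_itv/=; case: ltP => Ux; last by rewrite andbF.
    by rewrite andbT/= (le_trans (U0 t) (ltW Ux)).
  rewrite fubini_tonelli// [RHS]integral_mkcond; apply: eq_integral => x _.
  rewrite patchE /f/= indicE.
  case: ifPn => xa; last by rewrite integral0_eq// => t _; rewrite mul0r.
  under eq_integral do rewrite mul1r.
  by rewrite integral_ltr_nat.
have i1 : \int[lebesgue_measure]_(x in `[0%R, a]) (x / m)%:E = (a ^+ 2 / (2 * m))%:E.
  under eq_integral do rewrite mulrC EFinM -[X in (_ * X%:E)%E]expr1.
  rewrite ge0_integralZl//=.
  - by rewrite integral_exprn// -EFinM; congr EFin; field; rewrite gt_eqF.
  - by apply/measurable_EFinP; exact: measurable_funX.
  - by move=> x; rewrite in_itv/= => /andP[x0 _]; rewrite lee_fin exprn_ge0.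
  - by rewrite lee_fin invr_ge0 ltW.
have i2 : \int[lebesgue_measure]_(x in `[0%R, a]) ((x / m) ^+ 2)%:E = (a ^+ 3 / (3 * m ^+ 2))%:E.
  under eq_integral do rewrite mulrC exprMn EFinM.
  rewrite ge0_integralZl//=.
  - by rewrite integral_exprn// -EFinM; congr EFin; field; rewrite gt_eqF.
  - by apply/measurable_EFinP; exact: measurable_funX.
  - by move=> x; rewrite in_itv/= => /andP[x0 _]; rewrite lee_fin exprn_ge0.
  - by rewrite lee_fin sqr_ge0.
have m1 : measurable_fun `[0%R, a] (fun x : R => (x / m)%:E).
  by apply/measurable_EFinP; apply: measurable_funM.
have m2 : measurable_fun `[0%R, a] (fun x : R => ((x / m) ^+ 2)%:E).
  by apply/measurable_EFinP; apply: measurable_funX; apply: measurable_funM.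
have mF' : measurable_fun `[0%R, a] (fun x : R => P [set t | (U t < x)%R]).
  exact: measurable_funTS.
rewrite -i1 -i2; split.
  rewrite -ge0_integralD//=; last by move=> x _; rewrite lee_fin sqr_ge0.
  apply: ge0_le_integral => //=.
  - by move=> x; rewrite in_itv/= => /andP[x0 _]; rewrite lee_fin divr_ge0// ltW.
  - exact: emeasurable_funD.
  - by move=> x; rewrite in_itv/= => /andP[x0 _]; exact: (lU x0).1.
apply: ge0_le_integral => //=.
by move=> x; rewrite in_itv/= => /andP[x0 _]; exact: (lU x0).2.
Qed.

Context (V W : T -> R).
Hypotheses (V0 : forall t, (0 <= V t)%R) (W0 : forall t, (0 <= W t)%R).
Hypotheses (mV : measurable_fun [set: g_sigma_algebraType G] V).
Hypotheses (mW : measurable_fun [set: g_sigma_algebraType G] W).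

Let mVT := measurable_sub_sigma Gm mV.
Let mWT := measurable_sub_sigma Gm mW.

Let integral_weighted (h : R -> R -> R) :
  measurable_fun setT (fun z : R * R => h z.1 z.2) ->
  (forall x y, (0 <= h x y)%R) ->
  \int[P]_t (V t * h (U t) (W t))%:E =
  \int[P]_t ((V t)%:E * \int[P]_t' (h (U t') (W t))%:E).
Proof.
move=> mh h0.
(* [integral_indep] wants an integrand that is nonnegative everywhere, not only on the range of [V];
   hence the absolute value. *)
pose f (z : R * (R * R)) := (`|z.2.1| * h z.1 z.2.2)%:E.
have mf : measurable_fun setT f.
  apply/measurable_EFinP; apply: measurable_funM.
    by apply: measurableT_comp => //; exact: measurableT_comp.
  have mg : measurable_fun setT (fun z : R * (R * R) => (z.1, z.2.2)).
    apply/measurable_fun_pairP; split; first exact: measurable_fst.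
    exact: (measurableT_comp measurable_snd measurable_snd).
  exact: (measurableT_comp mh mg).
have f0 z : 0 <= f z by rewrite lee_fin mulr_ge0.
have mVW : measurable_fun [set: g_sigma_algebraType G] (fun t => (V t, W t)).
  exact/measurable_fun_pairP.
transitivity (\int[P]_t f (U t, (V t, W t))).
  by apply: eq_integral => t _; rewrite /f/= ger0_norm.
rewrite (integral_indep Gm UG mU mVW mf f0); apply: eq_integral => t _.
rewrite /f/=; under eq_integral do rewrite ger0_norm// EFinM.
rewrite ge0_integralZl//=.
- apply/measurable_EFinP.
  have mg : measurable_fun setT (fun z : T => (U z, W t)).
    by apply/measurable_fun_pairP; split; [exact: mU|exact: measurable_cst].
  exact: (measurableT_comp mh mg).
- by move=> x _; rewrite lee_fin.
- by rewrite lee_fin.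
Qed.

Let measurable_weighted (h : R -> R -> R) :
  measurable_fun setT (fun z : R * R => h z.1 z.2) ->
  (forall x y, (0 <= h x y)%R) ->
  measurable_fun setT (fun t => (V t)%:E * \int[P]_t' (h (U t') (W t))%:E).
Proof.
move=> mh h0; apply: emeasurable_funM; first exact/measurable_EFinP.
pose f (z : T * R) := (h (U z.1) z.2)%:E.
have mf : measurable_fun setT f.
  have mg : measurable_fun setT (fun z : T * R => (U z.1, z.2)).
    apply/measurable_fun_pairP; split; last exact: measurable_snd.
    exact: (measurableT_comp mU measurable_fst).
  by apply/measurable_EFinP; exact: (measurableT_comp mh mg).
have f0 z : 0 <= f z by rewrite lee_fin.
have mG : measurable_fun setT (fubini_G P f).
  exact: measurable_fun_fubini_tonelli_G.
exact: (measurableT_comp mG mWT).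
Qed.

(** With [V] and [W] frozen, the distribution bounds apply at x = [W t]. The weight [V] makes the
    lemma iterable: indicators still to be integrated and factors already produced are both put into
    it. *)
Lemma weighted_lt :
  \int[P]_t (V t * (W t / m))%:E <=
    \int[P]_t (V t * (U t < W t)%R%:R)%:E + \int[P]_t (V t * (W t / m) ^+ 2)%:E /\
  \int[P]_t (V t * (U t < W t)%R%:R)%:E <= \int[P]_t (V t * (W t / m))%:E.
Proof.
rewrite (integral_weighted (h := fun x y => (x < y)%R%:R)) => [|//|//]; last first.
  exact: measurable_ltr_nat.
have PU t : \int[P]_t' ((U t' < W t)%R%:R : R)%:E = P [set t' | (U t' < W t)%R].
  exact: integral_ltr_nat.
have [le_lower le_upper] := (fun t => (lU (W0 t)).1, fun t => (lU (W0 t)).2).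
have mPU : measurable_fun setT (fun t =>
    (V t)%:E * \int[P]_t' ((U t' < W t)%R%:R : R)%:E).
  apply: (measurable_weighted (h := fun x y => (x < y)%R%:R)) => //.
  exact: measurable_ltr_nat.
have W1 t : (0 <= V t * (W t / m))%R by rewrite mulr_ge0// divr_ge0// ltW.
have W2 t : (0 <= V t * (W t / m) ^+ 2)%R by rewrite mulr_ge0// sqr_ge0.
have mW1 : measurable_fun setT (fun t => (V t * (W t / m))%:E).
  by apply/measurable_EFinP; apply: measurable_funM => //; exact: measurable_funM.
have mW2 : measurable_fun setT (fun t => (V t * (W t / m) ^+ 2)%:E).
  apply/measurable_EFinP; apply: measurable_funM => //; apply: measurable_funX.
  exact: measurable_funM.
have PU0 t : 0 <= (V t)%:E * \int[P]_t' ((U t' < W t)%R%:R : R)%:E.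
  by rewrite PU mule_ge0// lee_fin.
split.
  rewrite -ge0_integralD//=; last by move=> t _; rewrite lee_fin.
  apply: ge0_le_integral => //=.
  - by move=> t _; rewrite lee_fin.
  - exact: emeasurable_funD.
  - move=> t _; rewrite PU EFinM [in leRHS]EFinM -ge0_muleDr ?lee_fin ?sqr_ge0//.
    by apply: lee_wpmul2l; rewrite ?lee_fin.
apply: ge0_le_integral => //= t _; rewrite PU EFinM.
by apply: lee_wpmul2l; rewrite ?lee_fin.
Qed.

(** The same freezing argument with [expect_pos_part]; it serves for [U h0], once the integration
    over another channel has produced the positive part. *)
Lemma weighted_pos_part :
  \int[P]_t (V t * (W t ^+ 2 / (2 * m)))%:E <=
    \int[P]_t (V t * Num.max 0 (W t - U t))%:E +
    \int[P]_t (V t * (W t ^+ 3 / (3 * m ^+ 2)))%:E /\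
  \int[P]_t (V t * Num.max 0 (W t - U t))%:E <=
    \int[P]_t (V t * (W t ^+ 2 / (2 * m)))%:E.
Proof.
have mh : measurable_fun setT (fun z : R * R => Num.max 0%R (z.2 - z.1)%R).
  by apply: measurable_maxr => //; exact: measurable_funB.
have h0 (x y : R) : (0 <= Num.max 0 (y - x))%R by rewrite le_max lexx.
rewrite (integral_weighted (h := fun x y => Num.max 0%R (y - x)%R))//.
have [le_lower le_upper] := (fun t => (expect_pos_part (W0 t)).1,
  fun t => (expect_pos_part (W0 t)).2).
have mPU := measurable_weighted (h := fun x y => Num.max 0%R (y - x)%R) mh (fun x y => h0 x y).
have W2 t : (0 <= V t * (W t ^+ 2 / (2 * m)))%R.
  by rewrite mulr_ge0// divr_ge0 ?sqr_ge0// mulr_ge0// ltW.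
have W3 t : (0 <= V t * (W t ^+ 3 / (3 * m ^+ 2)))%R.
  by rewrite mulr_ge0// divr_ge0 ?exprn_ge0// mulr_ge0// sqr_ge0.
have mWn n (c : R) : measurable_fun setT (fun t => (V t * (W t ^+ n / c))%:E).
  apply/measurable_EFinP; apply: measurable_funM => //; apply: measurable_funM => //.
  exact: measurable_funX.
have PU0 t : 0 <= (V t)%:E * \int[P]_t' (Num.max 0%R (W t - U t')%R)%:E.
  by rewrite mule_ge0 ?lee_fin//; apply: integral_ge0 => t' _; rewrite lee_fin.
split.
  rewrite -ge0_integralD//=; last by move=> t _; rewrite lee_fin.
  apply: ge0_le_integral => //=.
  - by move=> t _; rewrite lee_fin.
  - by apply: emeasurable_funD; [exact: mPU|exact: mWn].
  - move=> t _; rewrite EFinM [X in _ <= _ + X]EFinM -ge0_muleDr//.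
    + by apply: lee_wpmul2l; rewrite ?lee_fin.
    + by apply: integral_ge0 => t' _; rewrite lee_fin.
    + by rewrite lee_fin divr_ge0 ?exprn_ge0// mulr_ge0// sqr_ge0.
apply: ge0_le_integral => //=.
by move=> t _; rewrite EFinM; apply: lee_wpmul2l; rewrite ?lee_fin.
Qed.

End linear_cdf.

(** * Outage of a harmonic two-hop path with a direct path *)

Lemma harmonic_lt {R : realFieldType} (x y a : R) : 0 <= x -> 0 <= y ->
  (x < a) || (y < a) -> x * y / (x + y) < a.
Proof.
move=> x0 y0 xya; have [xy0|] := eqVneq (x + y) 0.
  (* Here the quotient is 0 by the convention on division, and [a] is positive because it exceeds
     [x] or [y]. *)
  by rewrite xy0 invr0 mulr0; case/orP: xya; apply: le_lt_trans.
move=> xyN0; have xy : 0 < x + y by rewrite lt_neqAle eq_sym xyN0 addr_ge0.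
by rewrite ltr_pdivrMr//; case/orP: xya => h; nra.
Qed.

(** If both x and y are at least (1+e)a, then xy < a(x+y) gives y < a x/(x-a), and x/(x-a) decreases
    in x, so it is at most its value (1+e)/e at x = (1+e)a. The roles of x and y are symmetric. *)
Lemma harmonic_lt_inv {R : realFieldType} (x y a e : R) :
  0 <= x -> 0 <= y -> 0 < e -> x * y / (x + y) < a ->
  [|| x < (1 + e) * a, y < (1 + e) * a |
      (x < (1 + e) / e * a) && (y < (1 + e) / e * a)].
Proof.
move=> x0 y0 e0 ha; have a0 : 0 < a.
  by apply: le_lt_trans ha; rewrite divr_ge0 ?mulr_ge0 ?addr_ge0.
have [//|xa /=] := ltP x ((1 + e) * a); have [//|ya /=] := ltP y ((1 + e) * a).
have xy : 0 < x + y by nra.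
move: ha; rewrite ltr_pdivrMr// => ha.
rewrite [_ / _ * _]mulrAC !ltr_pdivlMr//; apply/andP; split; nra.
Qed.

Lemma measurable_inv_ge0 {R : realType} d (T : measurableType d) (f : T -> R) :
  measurable_fun setT f -> (forall t, 0 <= f t) ->
  measurable_fun setT (fun t => (f t)^-1).
Proof.
move=> mf f0; rewrite (_ : (fun t => _) = (@powR R ^~ (-1)) \o f).
  by apply: measurableT_comp => //; exact: measurable_powR.
by apply/funext => t /=; rewrite powR_inv1.
Qed.

Unset Implicit Arguments.

Section three_hops.
Context {R : realType} {d : measure_display} {T : measurableType d}.
Context (P : probability T R).
(** [G k] stands for the information in everything except channel [k]: it is independent of [U k],
    while the other numerators and all the denominators are measurable for it. [Q] is one envelope
    for all denominators, so that a single third moment controls every error. *)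
Context (U : 'I_3 -> T -> R) (m : 'I_3 -> R) (G : 'I_3 -> set (set T)).
Context (A : 'I_3 -> T -> R) (Q : T -> R).
Hypotheses (m0 : forall k, 0 < m k) (U0 : forall k t, 0 <= U k t).
Hypotheses (mU : forall k, measurable_fun setT (U k)).
Hypothesis Gm : forall k, G k `<=` measurable.
Hypothesis UG : forall k, indep_from P (U k) (G k).
Hypothesis lU : forall k, linear_cdf P (U k) (m k).
Hypothesis mUG : forall k l, k != l ->
  measurable_fun [set: g_sigma_algebraType (G k)] (U l).
Hypothesis mAG : forall k l, measurable_fun [set: g_sigma_algebraType (G k)] (A l).
Hypotheses (A0 : forall k t, 0 < A k t) (AQ : forall k t, A k t <= Q t).
Hypothesis mQ : measurable_fun setT Q.
Hypothesis Q3 : (\int[P]_t (Q t ^+ 3)%:E < +oo)%E.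

Let M3 := Expect P (fun t => Q t ^+ 3).
Let mA k : measurable_fun setT (A k) := measurable_sub_sigma (Gm k) (mAG k k).
Let Q0 t : 0 < Q t := lt_le_trans (A0 h0 t) (AQ h0 t).
Let A0le k t : 0 <= A k t := ltW (A0 k t).

Let M3E : (\int[P]_t (Q t ^+ 3)%:E = M3%:E)%E.
Proof.
rewrite /M3 /Expect fineK// ge0_fin_numE//.
by apply: integral_ge0 => t _; rewrite lee_fin exprn_ge0// ltW.
Qed.

Let M30 : 0 <= M3.
Proof. by rewrite fine_ge0//; apply: integral_ge0 => t _; rewrite lee_fin exprn_ge0// ltW. Qed.

Let le_M3 (c : R) (f : T -> R) : 0 <= c -> measurable_fun setT f ->
  (forall t, 0 <= f t <= c * Q t ^+ 3) ->
  (\int[P]_t (f t)%:E <= (c * M3)%:E)%E.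
Proof.
move=> c0 mf fQ; rewrite EFinM -M3E -ge0_integralZl//=.
- apply: ge0_le_integral => //=.
  + by move=> t _; rewrite lee_fin; case/andP: (fQ t).
  + exact/measurable_EFinP.
  + by apply: emeasurable_funM => //; apply/measurable_EFinP; exact: measurable_funX.
  + by move=> t _; rewrite -EFinM lee_fin; case/andP: (fQ t).
- by apply/measurable_EFinP; exact: measurable_funX.
- by move=> t _; rewrite lee_fin exprn_ge0// ltW.
Qed.

Let AA k l := Expect P (fun t => A k t * A l t).

Let AAE k l : (\int[P]_t (A k t * A l t)%:E = (AA k l)%:E)%E.
Proof.
rewrite /AA /Expect fineK// ge0_fin_numE; last first.
  by apply: integral_ge0 => t _; rewrite lee_fin mulr_ge0.
(* Second moments are finite because q^2 <= 1 + q^3, by cases on q <= 1. *)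
apply: (@le_lt_trans _ _ (\int[P]_t (1 + (Q t ^+ 3)%:E))%E); last first.
  rewrite ge0_integralD//=.
  - by rewrite integral_cst//= probability_setT mule1 M3E -EFinD ltry.
  - by move=> t _; rewrite lee_fin exprn_ge0// ltW.
  - by apply/measurable_EFinP; exact: measurable_funX.
apply: ge0_le_integral => //=.
- by move=> t _; rewrite lee_fin mulr_ge0.
- by apply/measurable_EFinP; exact: measurable_funM.
- by apply: emeasurable_funD => //; apply/measurable_EFinP; exact: measurable_funX.
- move=> t _; rewrite -EFinD lee_fin.
  apply: (@le_trans _ _ (Q t * Q t)); first by rewrite ler_pM.
  have := Q0 t; move: (Q t) => q q0.
  have [q1|/ltW q1] := leP q 1.
    by rewrite (le_trans (_ : _ <= 1))//; [nra|rewrite lerDl exprn_ge0// ltW].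
  rewrite -expr2 exprS; have : 0 <= q ^+ 2 by exact: sqr_ge0.
  nra.
Qed.

Let integral_cA c k l : 0 <= c ->
  (\int[P]_t (c * (A k t * A l t))%:E = (c * AA k l)%:E)%E.
Proof.
move=> c0; under eq_integral do rewrite EFinM.
rewrite ge0_integralZl//=.
- by rewrite AAE.
- by apply/measurable_EFinP; exact: measurable_funM.
- by move=> t _; rewrite lee_fin mulr_ge0.
Qed.

(* [hop c g k / A k] is the positive part of [c * (g - U h0 / A h0)]. *)
Let hop c g k t := c * A k t / A h0 t * Num.max 0 (A h0 t * g - U h0 t).

Let mWG c g k l : l != h0 -> measurable_fun [set: g_sigma_algebraType (G l)] (hop c g k).
Proof.
move=> lh; apply: measurable_funM.
  apply: measurable_funM; first exact: measurable_funM.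
  exact: measurable_inv_ge0.
apply: measurable_maxr => //; apply: measurable_funB; last exact: mUG.
exact: measurable_funM.
Qed.

Let mW c g k : measurable_fun setT (hop c g k).
Proof. exact: measurable_sub_sigma (Gm h1) (mWG c g k h1 isT). Qed.

Let W0 c g k t : 0 <= c -> 0 <= hop c g k t.
Proof.
by move=> c0; rewrite mulr_ge0 ?le_max ?lexx// divr_ge0// mulr_ge0.
Qed.

Let Wm_integral c g k : (\int[P]_t (1 * (hop c g k t / m k))%:E =
  \int[P]_t (c * A k t / A h0 t / m k * Num.max 0 (A h0 t * g - U h0 t))%:E)%E.
Proof. by apply: eq_integral => t _; rewrite /hop mul1r mulrAC. Qed.

Let mV c k l : measurable_fun [set: g_sigma_algebraType (G l)]
  (fun t => c * A k t / A h0 t / m k).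
Proof.
apply: measurable_funM => //; apply: measurable_funM; first exact: measurable_funM.
exact: measurable_inv_ge0.
Qed.

Let PltE (V W : T -> R) : measurable_fun setT V -> measurable_fun setT W ->
  (\int[P]_t (1 * (V t < W t)%R%:R : R)%:E = P [set t | (V t < W t)%R])%E.
Proof.
by move=> mV' mW'; rewrite -integral_ltr_nat//; apply: eq_integral => t _; rewrite mul1r.
Qed.

(** Integrating [U k] and then [U h0] produces (A_0 g)^2/(2 m_0) times c A_k/(A_0 m_k); the division
    by A_0 built into [hop] cancels one of the two factors, which leaves E(A_k A_0). *)
Let hop_le c g k : k != h0 -> 0 <= c -> 0 <= g ->
  (P [set t | (U k t < hop c g k t)%R] <= (c * g ^+ 2 * (AA k h0 / (2 * m k * m h0)))%:E)%E.
Proof.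
move=> kh c0 g0.
have [_] := weighted_lt (m0 k) (mU k) (Gm k) (UG k) (lU k) (V := fun=> 1)
  (W := hop c g k) (fun _ => ler01) (fun t => W0 c g k t c0) (measurable_cst _) (mWG c g k k kh).
rewrite PltE// Wm_integral => /le_trans; apply.
have V0 t : 0 <= c * A k t / A h0 t / m k.
  by rewrite !divr_ge0 ?mulr_ge0// ltW.
have Ag0 t : 0 <= A h0 t * g by rewrite mulr_ge0.
have mAg : measurable_fun [set: g_sigma_algebraType (G h0)] (fun t => A h0 t * g).
  exact: measurable_funM.
have [_] := weighted_pos_part (m0 h0) (U0 h0) (mU h0) (Gm h0) (UG h0) (lU h0)
  V0 Ag0 (mV c k h0) mAg.
move=> /le_trans; apply.
rewrite [leLHS](_ : _ = \int[P]_t ((c * g ^+ 2 / (2 * m k * m h0)) * (A k t * A h0 t))%:E)%E.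
  rewrite integral_cA ?lee_fin; first by rewrite mulrAC -mulrA.
  by rewrite divr_ge0 ?mulr_ge0 ?sqr_ge0// ltW.
apply: eq_integral => t _; congr EFin; field.
by rewrite !gt_eqF.
Qed.

(** Each integration costs one correction: [c1] belongs to the quadratic term in the law of [U k],
    [c2] to the cubic term for the positive part in [U h0]. Both multiply a product of three
    denominators, bounded by Q^3. *)
Let hop_ge k : k != h0 -> exists2 C : R, 0 <= C & forall g, 0 <= g ->
  ((g ^+ 2 * (AA k h0 / (2 * m k * m h0)))%:E <=
   P [set t | (U k t < hop 1 g k t)%R] + (C * g ^+ 3)%:E)%E.
Proof.
move=> kh.
pose c1 := (m k ^+ 2 * m h0)^-1; pose c2 := (3 * m k * m h0 ^+ 2)^-1.
have c10 : 0 <= c1 by rewrite invr_ge0 mulr_ge0 ?sqr_ge0// ltW.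
have c20 : 0 <= c2 by rewrite invr_ge0 mulr_ge0 ?sqr_ge0 ?mulr_ge0// ltW.
exists (c1 * M3 + c2 * M3); first by rewrite addr_ge0 ?mulr_ge0.
move=> g g0.
have [+ _] := weighted_lt (m0 k) (mU k) (Gm k) (UG k) (lU k) (V := fun=> 1)
  (W := hop 1 g k) (fun _ => ler01) (fun t => W0 1 g k t ler01) (measurable_cst _)
  (mWG 1 g k k kh).
rewrite PltE// Wm_integral => le1.
have V0 t : 0 <= 1 * A k t / A h0 t / m k.
  by rewrite !divr_ge0 ?mulr_ge0// ltW.
have Ag0 t : 0 <= A h0 t * g by rewrite mulr_ge0.
have mAg : measurable_fun [set: g_sigma_algebraType (G h0)] (fun t => A h0 t * g).
  exact: measurable_funM.
have mAg' : measurable_fun setT (fun t => A h0 t * g) by exact: measurable_funM.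
have [+ _] := weighted_pos_part (m0 h0) (U0 h0) (mU h0) (Gm h0) (UG h0) (lU h0)
  V0 Ag0 (mV 1 k h0) mAg.
rewrite [leLHS](_ : _ = (g ^+ 2 * (AA k h0 / (2 * m k * m h0)))%:E); last first.
  transitivity (\int[P]_t ((g ^+ 2 / (2 * m k * m h0)) * (A k t * A h0 t))%:E)%E.
    by apply: eq_integral => t _; congr EFin; field; rewrite !gt_eqF.
  rewrite integral_cA; first by rewrite mulrAC -mulrA.
  by rewrite divr_ge0 ?mulr_ge0 ?sqr_ge0// ltW.
move=> /le_trans; apply.
have third : (\int[P]_t (1 * A k t / A h0 t / m k * ((A h0 t * g) ^+ 3 / (3 * m h0 ^+ 2)))%:E
    <= (c2 * M3 * g ^+ 3)%:E)%E.
  rewrite mulrAC.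
  rewrite [leLHS](_ : _ = \int[P]_t (c2 * g ^+ 3 * (A k t * A h0 t ^+ 2))%:E)%E; last first.
    by apply: eq_integral => t _; congr EFin; rewrite /c2; field; rewrite !gt_eqF.
  have cg0 : 0 <= c2 * g ^+ 3 by rewrite mulr_ge0// exprn_ge0.
  apply: le_M3 => //.
    by apply: measurable_funM => //; apply: measurable_funM => //; exact: measurable_funX.
  move=> t; rewrite mulr_ge0 ?mulr_ge0 ?sqr_ge0//=; apply: ler_wpM2l => //.
  by rewrite [Q t ^+ 3]exprS ler_pM ?sqr_ge0// ler_pXn2r ?nnegrE// ltW.
apply: le_trans (leeD le1 third) _.
rewrite -addeA leeD2l// mulrDl EFinD leeD2r//.
(* Where [hop] is nonzero one has [U h0 t < A h0 t * g], and [hop] is at most A_k g. Keeping this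
   indicator matters: its probability supplies the third factor g. *)
have sq t : (1 * (hop 1 g k t / m k) ^+ 2 <=
    (A k t * g / m k) ^+ 2 * (U h0 t < A h0 t * g)%R%:R)%R.
  rewrite mul1r /hop; case: ltP => h; last first.
    by rewrite max_l ?subr_le0// mulr0 mul0r expr0n mulr0.
  rewrite mulr1 ler_pXn2r ?nnegrE ?divr_ge0 ?W0 ?mulr_ge0// ?(ltW (m0 k))//.
    rewrite ler_pM2r ?invr_gt0// mul1r -mulrA ler_wpM2l//.
    rewrite max_r ?subr_ge0 ?(ltW h)// mulrC ler_pdivrMr//.
    by rewrite mulrC lerBlDr lerDl.
apply: (@le_trans _ _ (\int[P]_t ((A k t * g / m k) ^+ 2 * (U h0 t < A h0 t * g)%R%:R)%:E)%E).
  apply: ge0_le_integral => //=.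
  - by move=> t _; rewrite lee_fin mul1r sqr_ge0.
  - apply/measurable_EFinP; apply: measurable_funM => //; apply: measurable_funX.
    exact: measurable_funM.
  - apply/measurable_EFinP; apply: measurable_funM => //.
      by apply: measurable_funX; apply: measurable_funM => //; exact: measurable_funM.
    exact: measurable_ltr_nat.
  - by move=> t _; rewrite lee_fin.
have mV' : measurable_fun [set: g_sigma_algebraType (G h0)] (fun t => (A k t * g / m k) ^+ 2).
  by apply: measurable_funX; apply: measurable_funM => //; exact: measurable_funM.
have [_] := weighted_lt (m0 h0) (mU h0) (Gm h0) (UG h0) (lU h0)
  (fun t => sqr_ge0 (A k t * g / m k)) Ag0 mV' mAg.
move=> /le_trans; apply; rewrite mulrAC.
rewrite [leLHS](_ : _ = \int[P]_t (c1 * g ^+ 3 * (A k t ^+ 2 * A h0 t))%:E)%E; last first.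
  by apply: eq_integral => t _; congr EFin; rewrite /c1; field; rewrite !gt_eqF.
have cg0 : 0 <= c1 * g ^+ 3 by rewrite mulr_ge0// exprn_ge0.
apply: le_M3 => //.
  by apply: measurable_funM => //; apply: measurable_funM => //; exact: measurable_funX.
move=> t; rewrite mulr_ge0 ?mulr_ge0 ?sqr_ge0//=; apply: ler_wpM2l => //.
by rewrite [Q t ^+ 3]exprSr ler_pM ?sqr_ge0// ler_pXn2r ?nnegrE// ltW.
Qed.

(** Each of the three independent numerators below a threshold linear in g contributes a factor g.
    They are removed one by one, the remaining indicators and the factors already obtained acting as
    weight. *)
Let joint_le K : 0 <= K -> exists2 C : R, 0 <= C & forall g, 0 <= g ->
  (P [set t | [/\ U h0 t < A h0 t * g, U h1 t < A h1 t * (K * g) &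
                  U h2 t < A h2 t * (K * g)]%R] <= (C * g ^+ 3)%:E)%E.
Proof.
move=> K0.
exists (K ^+ 2 / (m h0 * m h1 * m h2) * M3).
  by rewrite mulr_ge0// divr_ge0 ?sqr_ge0// !mulr_ge0// ltW.
move=> g g0.
have AK0 k t c : 0 <= c -> 0 <= A k t * c by move=> ?; rewrite mulr_ge0.
have mAK l k c : measurable_fun [set: g_sigma_algebraType (G l)] (fun t => A k t * c).
  exact: measurable_funM.
have mAKT k c : measurable_fun setT (fun t => A k t * c) by exact: measurable_funM.
pose I k c t : R := (U k t < A k t * c)%R%:R.
have I0 k c t : 0 <= I k c t by [].
have mI l k c : l != k -> measurable_fun [set: g_sigma_algebraType (G l)] (I k c).
  by move=> lk; apply: measurable_ltr_nat; [exact: mUG|exact: mAK].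
have mIT k c : measurable_fun setT (I k c) by exact: measurable_ltr_nat.
have Kg0 : 0 <= K * g by rewrite mulr_ge0.
rewrite [leLHS](_ : _ =
    \int[P]_t ((I h0 g t * I h1 (K * g) t) * I h2 (K * g) t)%:E)%E; last first.
  pose S k c := [set t | (U k t < A k t * c)%R].
  have mS k c : measurable (S k c) by exact: measurable_set_ltr.
  have IE k c t : I k c t = \1_(S k c) t.
    by rewrite indicE; congr ((nat_of_bool _)%:R); apply/idP/idP; rewrite inE.
  under [RHS]eq_integral do rewrite !IE !indicE -!natrM !mulnb -!in_setI -indicE.
  rewrite integral_indic ?setIT//; last by apply: measurableI => //; exact: measurableI.
  by congr (P _); apply/seteqP; split => t; [case|case; case].
have V1 t : 0 <= I h0 g t * I h1 (K * g) t by rewrite mulr_ge0.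
have mV1 : measurable_fun [set: g_sigma_algebraType (G h2)] (fun t => I h0 g t * I h1 (K * g) t).
  by apply: measurable_funM; exact: mI.
have [_] := weighted_lt (m0 h2) (mU h2) (Gm h2) (UG h2) (lU h2)
  V1 (fun t => AK0 h2 t _ Kg0) mV1 (mAK h2 h2 (K * g)).
move=> /le_trans; apply.
have V2 t : 0 <= I h0 g t * (A h2 t * (K * g) / m h2).
  by rewrite mulr_ge0// divr_ge0 ?AK0// ltW.
have mV2 : measurable_fun [set: g_sigma_algebraType (G h1)]
    (fun t => I h0 g t * (A h2 t * (K * g) / m h2)).
  apply: measurable_funM; first exact: mI.
  by apply: measurable_funM => //; exact: mAK.
have [_] := weighted_lt (m0 h1) (mU h1) (Gm h1) (UG h1) (lU h1)
  V2 (fun t => AK0 h1 t _ Kg0) mV2 (mAK h1 h1 (K * g)).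
under eq_integral do rewrite mulrAC.
move=> /le_trans; apply.
have V3 t : 0 <= (A h2 t * (K * g) / m h2) * (A h1 t * (K * g) / m h1).
  by rewrite mulr_ge0// divr_ge0 ?AK0// ltW.
have mV3 : measurable_fun [set: g_sigma_algebraType (G h0)]
    (fun t => (A h2 t * (K * g) / m h2) * (A h1 t * (K * g) / m h1)).
  by apply: measurable_funM; apply: measurable_funM => //; exact: mAK.
have [_] := weighted_lt (m0 h0) (mU h0) (Gm h0) (UG h0) (lU h0)
  V3 (fun t => AK0 h0 t _ g0) mV3 (mAK h0 h0 g).
rewrite [X in (X <= _)%E -> _](_ : _ = \int[P]_t (I h0 g t *
   (A h2 t * (K * g) / m h2) * (A h1 t * (K * g) / m h1))%:E)%E; last first.
  by apply: eq_integral => t _; congr EFin; exact: (etrans (mulrC _ _) (mulrA _ _ _)).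
move=> /le_trans; apply; rewrite mulrAC.
set c := K ^+ 2 / _ * _.
rewrite [leLHS](_ : _ = \int[P]_t (c * (A h2 t * A h1 t * A h0 t))%:E)%E; last first.
  by apply: eq_integral => t _; congr EFin; rewrite /c; field; rewrite !gt_eqF.
have c0 : 0 <= c.
  by rewrite /c mulr_ge0 ?exprn_ge0// divr_ge0 ?sqr_ge0// !mulr_ge0// ltW.
move: c c0 => c c0.
apply: le_M3 => //.
  by apply: measurable_funM => //; apply: measurable_funM => //; exact: measurable_funM.
move=> t; apply/andP; split; first by rewrite !mulr_ge0.
apply: ler_wpM2l => //.
by rewrite [Q t ^+ 3]exprSr expr2 ler_pM ?mulr_ge0// ler_pM.
Qed.

(** * Sandwich for the outage probability and its limit *)

Let kappa := AA h1 h0 / (2 * m h1 * m h0) + AA h2 h0 / (2 * m h2 * m h0).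

Let X k t := U k t / A k t.

Let p g := Prob_lt P (fun t => X h0 t + X h1 t * X h2 t / (X h1 t + X h2 t)) g.

Let X0 k t : 0 <= X k t. Proof. by rewrite divr_ge0. Qed.

Let mX k : measurable_fun setT (X k).
Proof. by apply: measurable_funM => //; exact: measurable_inv_ge0. Qed.

(** Multiplication by the positive denominators. Taking the positive part in [hop] changes nothing:
    [X k] is nonnegative, so both sides are false when g - D <= 0. *)
Let hopE c g k t : 0 < c -> (U k t < hop c g k t) = (X k t < c * (g - X h0 t)).
Proof.
move=> c0; rewrite /hop.
have -> : Num.max 0 (A h0 t * g - U h0 t) = A h0 t * Num.max 0 (g - X h0 t).
  by rewrite maxr_pMr// mulr0 mulrBr /X mulrCA divff ?mulr1// gt_eqF.
rewrite mulrA divfK ?gt_eqF// mulrAC -ltr_pdivrMr// -/(X k t).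
have [|h] := ltP 0 (g - X h0 t); first by [].
rewrite mulr0; apply/idP/idP => /lt_le_trans Xlt.
  by have := Xlt 0 (lexx _); rewrite ltNge X0.
have := Xlt 0; rewrite ltNge X0 => /(_ _)/contraTT; apply => //.
by rewrite pmulr_rle0.
Qed.

Let mUps : measurable_fun setT
  (fun t => X h0 t + X h1 t * X h2 t / (X h1 t + X h2 t)).
Proof.
apply: measurable_funD => //; apply: measurable_funM; first exact: measurable_funM.
by apply: measurable_inv_ge0; [exact: measurable_funD|move=> t; rewrite addr_ge0].
Qed.

Let AA0 k l : 0 <= AA k l.
Proof.
by rewrite fine_ge0//; apply: integral_ge0 => t _; rewrite lee_fin mulr_ge0.
Qed.

Lemma outage_bounds e : 0 < e -> exists2 C : R, 0 <= C & forall g, 0 < g ->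
  `|p g - kappa * g ^+ 2| <= e * kappa * g ^+ 2 + C * g ^+ 3.
Proof.
move=> e0.
pose K := (1 + e) / e.
have K0 : 0 <= K by rewrite divr_ge0 ?addr_ge0// ltW.
have [C1 C10 hop1] := hop_ge h1 isT.
have [C2 C20 hop2] := hop_ge h2 isT.
have [C3 C30 joint1] := joint_le 1 ler01.
have [C4 C40 jointK] := joint_le K K0.
(* [C1], [C2], [C3] come from the lower bound and [C4] from the upper one. *)
exists (C1 + C2 + C3 + C4); first by rewrite !addr_ge0.
move=> g g0.
pose pr S := fine (P S).
have PE S : measurable S -> P S = (pr S)%:E by move=> mS; rewrite fineK// fin_num_measure.
pose S c k := [set t | U k t < hop c g k t].
have mS c k : measurable (S c k) by exact: measurable_set_ltr.
pose J c := [set t | [/\ U h0 t < A h0 t * g, U h1 t < A h1 t * (c * g) &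
                  U h2 t < A h2 t * (c * g)]%R].
have mAK k c : measurable_fun setT (fun t => A k t * c) by exact: measurable_funM.
have mJ c : measurable (J c).
  rewrite (_ : J c = [set t | U h0 t < A h0 t * g] `&`
    [set t | U h1 t < A h1 t * (c * g)] `&` [set t | U h2 t < A h2 t * (c * g)]).
    by apply: measurableI; [apply: measurableI|]; exact: measurable_set_ltr.
  by apply/seteqP; split => t; [case|case; case].
pose O := [set t | X h0 t + X h1 t * X h2 t / (X h1 t + X h2 t) < g].
have mO : measurable O by exact: measurable_set_ltr.
(* Nonnegativity of [X k] forces D < g; the threshold c(g - D) is then relaxed to cg, which
   decouples the three channels. *)
have UX c k t : 0 < c -> X k t < c * (g - X h0 t) ->
    U h0 t < A h0 t * g /\ U k t < A k t * (c * g).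
  move=> c0 Xk; have a0 : 0 < g - X h0 t.
    by rewrite -(pmulr_rgt0 _ c0); exact: le_lt_trans (X0 k t) Xk.
  rewrite [A h0 t * g]mulrC [A k t * (c * g)]mulrC -!(ltr_pdivrMr _ _ (A0 _ t)).
  split; first by rewrite -subr_gt0.
  by apply: lt_le_trans Xk _; rewrite ler_pM2l// lerBlDr lerDl.
(* Inclusion-exclusion: the overlap of the two single-hop events lies in the triple intersection
   with constant 1. *)
have lower : pr (S 1 h1) + pr (S 1 h2) <= p g + pr (J 1).
  have mSI := measurableI _ _ (mS 1 h1) (mS 1 h2).
  have mSU := measurableU _ _ (mS 1 h1) (mS 1 h2).
  pose SU := S 1 h1 `|` S 1 h2; pose SI := S 1 h1 `&` S 1 h2.
  pose S1 := S 1 h1; pose S2 := S 1 h2.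
  have : (P SU = P S1 + P S2 - P SI)%E.
    by apply: measureUfinl => //; rewrite -ge0_fin_numE// fin_num_measure.
  rewrite (PE SU mSU) (PE S1 (mS _ _)) (PE S2 (mS _ _)) (PE SI mSI).
  rewrite -EFinD => -[SUE].
  have : pr (S 1 h1 `|` S 1 h2) <= p g.
    rewrite -lee_fin -[in leRHS]/(pr O) -!PE//; apply: le_measure; rewrite ?inE//.
    move=> t /= SUt; have : (X h1 t < g - X h0 t) || (X h2 t < g - X h0 t).
      by apply/orP; case: SUt; rewrite /S/= hopE// mul1r; [left|right].
    by move/(harmonic_lt (X0 h1 t) (X0 h2 t)); rewrite ltrBrDl.
  have : pr (S 1 h1 `&` S 1 h2) <= pr (J 1).
    rewrite -lee_fin -!PE//; apply: le_measure; rewrite ?inE//.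
    move=> t [] /=; rewrite /S/= !hopE// => /(UX _ _ _ ltr01)[h00 h11].
    by move=> /(UX _ _ _ ltr01)[_ h22].
  by move: SUE; rewrite /SU /SI /S1 /S2; lra.
have upper : p g <= pr (S (1 + e) h1) + pr (S (1 + e) h2) + pr (J K).
  have e1 : 0 < 1 + e by rewrite addr_gt0.
  have mSU := measurableU _ _ (mS (1 + e) h1) (mS (1 + e) h2).
  apply: (@le_trans _ _ (pr (S (1 + e) h1 `|` S (1 + e) h2 `|` J K))).
    rewrite -lee_fin -[in leLHS]/(pr O) -!PE//; last exact: measurableU.
    apply: le_measure; rewrite ?inE//; first exact: measurableU.
    move=> t /=; rewrite addrC -ltrBrDr => Ot.
    have /or3P[Xt|Xt|/andP[X1t X2t]] :=
      harmonic_lt_inv (X0 h1 t) (X0 h2 t) e0 Ot.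
    - by left; left; rewrite /S/= hopE.
    - by left; right; rewrite /S/= hopE.
    - right; have Kp : 0 < K by rewrite divr_gt0.
      have [h00 h11] := UX _ _ _ Kp X1t; have [_ h22] := UX _ _ _ Kp X2t.
      by split.
  rewrite -lee_fin !EFinD -!PE//; last exact: measurableU.
  by apply: le_trans (measureU2 _ _ _) _ => //; rewrite leeD2r// measureU2.
have e1 : 0 <= 1 + e by rewrite addr_ge0// ltW.
have := hop1 g (ltW g0); have := hop2 g (ltW g0).
have := joint1 g (ltW g0); have := jointK g (ltW g0).
have := hop_le (1 + e) g h1 isT e1 (ltW g0); have := hop_le (1 + e) g h2 isT e1 (ltW g0).
rewrite -!/(S _ _) -!/(J _) !PE// -!EFinD !lee_fin.
rewrite ler_norml /kappa.
set k1 := AA h1 h0 / _; set k2 := AA h2 h0 / _.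
have g2 : 0 <= g ^+ 2 by exact: sqr_ge0.
have g3 : 0 <= g ^+ 3 by rewrite exprn_ge0// ltW.
have k1G : 0 <= k1 * g ^+ 2 by rewrite mulr_ge0// divr_ge0// ?mulr_ge0// ltW.
have k2G : 0 <= k2 * g ^+ 2 by rewrite mulr_ge0// divr_ge0// ?mulr_ge0// ltW.
move: (g ^+ 2) (g ^+ 3) g2 g3 k1G k2G => G2 G3 g2 g3 k1G k2G q1 q2 q3 q4 q5 q6.
have C1G : 0 <= C1 * G3 by rewrite mulr_ge0.
have C2G : 0 <= C2 * G3 by rewrite mulr_ge0.
have C3G : 0 <= C3 * G3 by rewrite mulr_ge0.
have C4G : 0 <= C4 * G3 by rewrite mulr_ge0.
have ek1 : 0 <= e * (k1 * G2) by rewrite mulr_ge0// ltW.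
have ek2 : 0 <= e * (k2 * G2) by rewrite mulr_ge0// ltW.
apply/andP; split; lra.
Qed.

Lemma outage_cvg : (p g / g ^+ 2) @[g --> 0^'+] --> kappa.
Proof.
have k0 : 0 <= kappa.
  by rewrite addr_ge0// divr_ge0// ?mulr_ge0// ltW.
apply/cvgrPdist_lt => eps eps0.
(* Chosen so that [e * kappa] is below eps/2. The constant [C] depends on [e], so the range of g is
   fixed afterwards; the added 1 keeps the denominators positive. *)
pose e := eps / (2 * (kappa + 1)).
have k1 : 0 < kappa + 1 by rewrite ltr_wpDl.
have e0 : 0 < e by rewrite divr_gt0// mulr_gt0.
have [C C0 bound] := outage_bounds e e0.
have d0 : 0 < eps / (2 * (C + 1)) by rewrite divr_gt0// mulr_gt0// ltr_wpDl.
near=> g.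
have g0 : 0 < g by near: g; exact: nbhs_right_gt.
have gd : g < eps / (2 * (C + 1)) by near: g; exact: nbhs_right_lt.
have g2 : 0 < g ^+ 2 by rewrite exprn_gt0.
rewrite distrC -[kappa](mulfK (lt0r_neq0 g2)) -mulrBl normrM [X in _ * X]gtr0_norm ?invr_gt0//.
rewrite ltr_pdivrMr//; apply: le_lt_trans (bound g g0) _.
have ek : e * kappa < eps / 2.
  rewrite /e invfM mulrA mulrAC ltr_pdivrMr// ltr_pM2l ?divr_gt0//.
  by rewrite ltrDl.
have Cg : C * g <= eps / 2.
  move: gd; rewrite invfM mulrA ltr_pdivlMr ?ltr_wpDl//; nra.
rewrite [C * _](_ : _ = C * g * g ^+ 2); last by ring.
by rewrite -mulrDl ltr_pM2r//; lra.
Unshelve. all: by end_near. Qed.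

End three_hops.

Set Implicit Arguments.

(** * Moments and laws *)

Section probability_facts.
Context {R : realType} {d : measure_display} {T : measurableType d}.
Context (P : probability T R).

Lemma integral_is_normal0 (X : {RV P >-> R}) v (f : R -> \bar R) :
  is_normal0 X v -> measurable_fun setT f -> (forall x, 0 <= f x)%E ->
  (\int[P]_t f (X t) = \int[normal_prob 0 (Num.sqrt v)]_x f x)%E.
Proof.
move=> nX mf f0.
(* [normal_prob] is a measure on [measurableTypeR R], whose display is not that
   of [R]: the distribution of [X] has to be taken on that type as well. *)
have mX : measurable_fun setT (X : T -> measurableTypeR R).
  exact: (measurable_funP X).
pose mX_mixin := @isMeasurableFun.Build _ _ T (measurableTypeR R) X mX.
pose X' : {mfun T >-> measurableTypeR R} := HB.pack (X : T -> measurableTypeR R) mX_mixin.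
transitivity (\int[distribution P X']_x f x)%E.
  by rewrite ge0_integral_distribution.
by apply: eq_measure_integral => A mA _; exact: nX.
Qed.

(** The variable is exponential with mean 2cv, but its exact law is bypassed: the event says that
    the pair lies in the disk of squared radius x/c, and independence reduces its probability to the
    integral in [normal_disk_bounds]. *)
Lemma normal_pair_linear_cdf (X Y : {RV P >-> R}) (v c : R) (G : set (set T)) :
  0 < v -> 0 < c -> is_normal0 X v -> is_normal0 Y v -> G `<=` measurable ->
  indep_from P X G -> measurable_fun [set: g_sigma_algebraType G] Y ->
  linear_cdf P (fun t => c * (X t ^+ 2 + Y t ^+ 2)) (c * (2 * v)).
Proof.
move=> v0 c0 nX nY Gm XG mY x x0.
have mX : measurable_fun setT X by exact: measurable_funP.
have mY' : measurable_fun setT Y by exact: measurable_funP.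
pose y := x / c.
have y0 : 0 <= y by rewrite divr_ge0// ltW.
pose f (z : R * R) : \bar R := ((z.2 ^+ 2 + z.1 ^+ 2 < y)%R%:R : R)%:E.
have mf : measurable_fun setT f.
  apply/measurable_EFinP; apply: measurable_ltr_nat => //.
  by apply: measurable_funD; apply: measurable_funX; [exact: measurable_snd|exact: measurable_fst].
have f0 z : (0 <= f z)%E by rewrite lee_fin.
have mfw w : measurable_fun setT (fun u => f (u, w)).
  apply/measurable_EFinP.
  apply: (measurable_ltr_nat (f := fun u : R => w ^+ 2 + u ^+ 2)) => //.
  by apply: measurable_funD; [exact: measurable_cst|exact: measurable_funX].
have PE : (P [set t | (c * (X t ^+ 2 + Y t ^+ 2) < x)%R] =
    \int[normal_prob 0 (Num.sqrt v)]_w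
      normal_prob 0 (Num.sqrt v) [set u : R | ((w : R) ^+ 2 + u ^+ 2 < y)%R])%E.
  transitivity (\int[P]_t f (X t, Y t))%E.
    rewrite integral_ltr_nat//; last first.
      by apply: measurable_funD; exact: measurable_funX.
    congr (P _); apply/funext => t /=; congr is_true.
    by rewrite /y ltr_pdivlMr// [in RHS]mulrC [in RHS]addrC.
  rewrite (integral_indep Gm XG mX mY mf f0).
  transitivity (\int[P]_t (fubini_G (normal_prob 0 (Num.sqrt v)) f) (Y t))%E.
    by apply: eq_integral => t _; rewrite (integral_is_normal0 nX (mfw (Y t)))//.
  rewrite (integral_is_normal0 nY).
  - apply: eq_integral => w _; rewrite /fubini_G /f/=.
    rewrite integral_ltr_nat//.
    by apply: measurable_funD; [exact: measurable_cst|exact: measurable_funX].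
  - exact: measurable_fun_fubini_tonelli_G.
  - by move=> w; apply: integral_ge0.
have s0 : 0 < Num.sqrt v by rewrite sqrtr_gt0.
have /andP := normal_disk_bounds s0 y0.
rewrite -PE sqr_sqrtr ?(ltW v0)// (_ : y / (2 * v) = x / (c * (2 * v))); last first.
  by rewrite /y [(c * _)^-1]invfM mulrA.
by case=> lo up; split; [rewrite -leeBlDr|].
Qed.

Lemma expectM_indep (X Y : T -> R) (G : set (set T)) :
  G `<=` measurable -> indep_from P X G -> measurable_fun setT X ->
  measurable_fun [set: g_sigma_algebraType G] Y ->
  (forall t, 0 <= X t) -> (forall t, 0 <= Y t) ->
  (\int[P]_t (X t)%:E < +oo)%E -> (\int[P]_t (Y t)%:E < +oo)%E ->
  Expect P (fun t => X t * Y t) = Expect P X * Expect P Y.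
Proof.
move=> Gm XG mX mY X0 Y0 Xoo Yoo; have mY' := measurable_sub_sigma Gm mY.
pose f (z : R * R) := (`|z.1 * z.2|)%:E.
have mf : measurable_fun setT f.
  apply/measurable_EFinP; apply: measurableT_comp => //.
  by apply: measurable_funM; [exact: measurable_fst|exact: measurable_snd].
have f0 z : (0 <= f z)%E by rewrite lee_fin.
have XYE : (\int[P]_t (X t * Y t)%:E = \int[P]_t (X t)%:E * \int[P]_t (Y t)%:E)%E.
  transitivity (\int[P]_t f (X t, Y t))%E.
    by apply: eq_integral => t _; rewrite /f/= ger0_norm// mulr_ge0.
  rewrite (integral_indep Gm XG mX mY mf f0) muleC -ge0_integralZr//=.
  - apply: eq_integral => t _; rewrite -ge0_integralZl//=.
    + by apply: eq_integral => u _; rewrite /f/= ger0_norm ?mulr_ge0// mulrC EFinM.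
    + exact/measurable_EFinP.
    + by move=> u _; rewrite lee_fin.
    + by rewrite lee_fin.
  - exact/measurable_EFinP.
  - by move=> u _; rewrite lee_fin.
  - by apply: integral_ge0 => t _; rewrite lee_fin.
rewrite /Expect XYE fineM// ge0_fin_numE//; apply: integral_ge0 => t _.
  by rewrite lee_fin.
by rewrite lee_fin.
Qed.

Definition finite_moment3 (f : T -> R) :=
  [/\ measurable_fun setT f, forall t, 0 <= f t &
      (\int[P]_t (f t ^+ 3)%:E < +oo)%E].

Lemma finite_moment3_cst c : 0 <= c -> finite_moment3 (fun=> c).
Proof.
move=> c0; split=> //.
by rewrite integral_cst//= probability_setT mule1 ltry.
Qed.

Lemma finite_moment3Z c f : 0 <= c -> finite_moment3 f ->
  finite_moment3 (fun t => c * f t).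
Proof.
move=> c0 [mf f0 f3]; split.
- exact: measurable_funM.
- by move=> t; rewrite mulr_ge0.
- under eq_integral do rewrite exprMn EFinM.
  rewrite ge0_integralZl//=.
  + by rewrite lte_mul_pinfty// lee_fin exprn_ge0.
  + by apply/measurable_EFinP; exact: measurable_funX.
  + by move=> t _; rewrite lee_fin exprn_ge0.
  + by rewrite lee_fin exprn_ge0.
Qed.

Lemma finite_moment3D f g : finite_moment3 f -> finite_moment3 g ->
  finite_moment3 (fun t => f t + g t).
Proof.
move=> [mf f0 f3] [mg g0 g3].
have mX (h : T -> R) : measurable_fun setT h -> measurable_fun setT (fun t => (h t ^+ 3)%:E).
  by move=> mh; apply/measurable_EFinP; exact: measurable_funX.
have X0 (h : T -> R) : (forall t, 0 <= h t) -> forall t, setT t -> (0 <= (h t ^+ 3)%:E)%E.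
  by move=> h0 t _; rewrite lee_fin exprn_ge0.
have mfg : measurable_fun setT (fun t => f t + g t) by exact: measurable_funD.
split=> [//|t|]; first by rewrite addr_ge0.
apply: (@le_lt_trans _ _ (\int[P]_t (4%:E * ((f t ^+ 3)%:E + (g t ^+ 3)%:E)))%E).
  apply: ge0_le_integral => //.
  - by apply: X0 => t; rewrite addr_ge0.
  - exact: mX.
  - apply: emeasurable_funM => //; apply: emeasurable_funD; exact: mX.
  - move=> t _; rewrite -EFinD -EFinM lee_fin.
    have := f0 t; have := g0 t; move: (f t) (g t) => a b b0 a0.
    (* 4(a^3 + b^3) - (a + b)^3 = 3 (a + b)(a - b)^2. *)
    have := mulr_ge0 (addr_ge0 a0 b0) (sqr_ge0 (a - b)).
    by nra.
rewrite ge0_integralZl//=.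
- rewrite ge0_integralD//=.
  + by rewrite lte_mul_pinfty// lte_add_pinfty.
  + exact: X0.
  + exact: mX.
  + exact: X0.
  + exact: mX.
- by apply: emeasurable_funD; exact: mX.
- by move=> t _; rewrite adde_ge0//; exact: X0.
Qed.

Lemma finite_moment3_sum n (f : 'I_n -> T -> R) :
  (forall i, finite_moment3 (f i)) -> finite_moment3 (fun t => \sum_(i < n) f i t).
Proof.
move=> ff; elim: n f ff => [|n IH] f ff.
  rewrite (_ : (fun t => _) = fun=> 0); first exact: finite_moment3_cst.
  by apply/funext => t; rewrite big_ord0.
rewrite (_ : (fun t => _) = fun t => \sum_(i < n) f (widen_ord (leqnSn n) i) t + f ord_max t).
  by apply: finite_moment3D => //; exact: IH.
by apply/funext => t; rewrite big_ord_recr.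
Qed.

Lemma finite_moment3_sqr_normal (X : {RV P >-> R}) v : 0 < v ->
  is_normal0 X v -> finite_moment3 (fun t => X t ^+ 2).
Proof.
move=> v0 nX; have mX : measurable_fun setT X by exact: measurable_funP.
split; [exact: measurable_funX|by move=> t; exact: sqr_ge0|].
under eq_integral do rewrite -exprM.
rewrite (integral_is_normal0 (f := fun x => (x ^+ 6)%:E) nX).
- by apply: normal_moment6; rewrite sqrtr_gt0.
- by apply/measurable_EFinP; exact: exprn_measurable.
- by move=> x; rewrite lee_fin (exprM x 3 2) sqr_ge0.
Qed.

End probability_facts.

(** * The relay network *)

Section relay_model.
Context {R : realType} {d : measure_display} {T : measurableType d}.
Context (P : probability T R).
Context (Pw : R) (Om : 'I_3 -> R) (L : 'I_3 -> nat) (PI : 'I_3 -> R).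
Context (OmC : 'I_3 -> nat -> R) (Z : gidx -> {RV P >-> R}).
Hypotheses (Pw0 : 0 < Pw) (Om0 : forall i, 0 < Om i).
Hypotheses (PI0 : forall N, 0 < PI N).
Hypothesis OmC0 : forall N k, (k < L N)%N -> 0 < OmC N k.
Hypothesis nh : forall i, is_CN0 (Z (inl i, false)) (Z (inl i, true)) (Om i).
Hypothesis nc : forall N k, (k < L N)%N ->
  is_CN0 (Z (inr (N, k), false)) (Z (inr (N, k), true)) (OmC N k).
Hypothesis indZ : mutually_independent (relevant L) Z.

(** An enumeration of the Gaussian components present in the model; [undup] provides the uniqueness
    that [mutually_independent] asks of its index lists. *)
Let idx : seq gidx := undup
  ([seq (inl i, b) | i <- enum 'I_3, b <- [:: false; true]] ++
   [seq (inr Nk, b) | Nk <- [seq (N, k) | N <- enum 'I_3, k <- iota 0 (L N)],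
                      b <- [:: false; true]]).

Let mem_idx j : relevant L j -> j \in idx.
Proof.
have bb (b : bool) : b \in [:: false; true] by case: b.
case: j => [[i|[N k]] b]; rewrite /relevant/= /idx mem_undup mem_cat => jL.
  by apply/orP; left; apply/allpairsP; exists (i, b); rewrite /= mem_enum bb.
apply/orP; right; apply/allpairsP; exists ((N, k), b); rewrite /= bb; split=> //.
apply/allpairsPdep; exists N, k; split=> //; first by rewrite mem_enum.
by rewrite mem_iota.
Qed.

Let idx_relevant j : j \in idx -> relevant L j.
Proof.
rewrite /idx mem_undup mem_cat => /orP[] /allpairsP[[x b] /= [xs _ ->]] //.
by case/allpairsPdep: xs => N [k [_ + ->]]; rewrite mem_iota.
Qed.

(* Generates the sigma-algebra of the Gaussian components selected by [a]. *)
Let G (a : pred gidx) := cylinders Z [seq j <- idx | a j].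

Let Gm a : G a `<=` measurable. Proof. exact: cylinders_measurable. Qed.

Let mZ (a : pred gidx) j : relevant L j -> a j ->
  measurable_fun [set: g_sigma_algebraType (G a)] (Z j).
Proof.
move=> jL aj _ B mB; rewrite setTI; apply: sub_sigma_algebra.
by apply: cylinders_preimage => //; rewrite mem_filter aj mem_idx.
Qed.

(** Disjoint selections of Gaussian components generate independent sigma-algebras. All independence
    used for the network is an instance of this. *)
Let G_indep (a b : pred gidx) (U : T -> R) : (forall j, a j -> ~~ b j) ->
  measurable_fun [set: g_sigma_algebraType (G a)] U -> indep_from P U (G b).
Proof.
move=> ab mU A B mA sB; apply: (indep_sigma indZ (s1 := [seq j <- idx | a j]) _ _ _ sB).
- rewrite cat_uniq !filter_uniq ?undup_uniq// andbT/=.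
  apply/hasPn => j; rewrite !mem_filter => /andP[bj _]; apply/negP => /andP[aj _].
  by have := ab _ aj; rewrite bj.
- by move=> j; rewrite mem_cat !mem_filter => /orP[]/andP[_ /idx_relevant].
- by rewrite -[X in <<s _ >> X]setTI; exact: mU.
Qed.

Let channel k : pred gidx := fun j => if j.1 is inl i then i == k else false.
Let node N : pred gidx := fun j => if j.1 is inr Nk then Nk.1 == N else false.

Let mgam (a : pred gidx) (k : 'I_3) : (forall b : bool, a ((inl k, b) : gidx)) ->
  measurable_fun [set: g_sigma_algebraType (G a)] (gam Z Pw k).
Proof.
move=> ak; apply: measurable_funM => //; apply: measurable_funD;
  apply: measurable_funX; exact: mZ.
Qed.

Let mGam (a : pred gidx) (N : 'I_3) : (forall (k : nat) (b : bool), a ((inr (N, k), b) : gidx)) ->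
  measurable_fun [set: g_sigma_algebraType (G a)] (Gam Z L PI N).
Proof.
move=> aN; apply: measurable_sum => k; apply: measurable_funM => //.
apply: measurable_funD; apply: measurable_funX; apply: mZ => //; exact: ltn_ord.
Qed.

Let gam_ge0 k t : 0 <= gam Z Pw k t.
Proof. by rewrite mulr_ge0 ?(ltW Pw0)// addr_ge0// sqr_ge0. Qed.

Let Gam_ge0 N t : 0 <= Gam Z L PI N t.
Proof.
by apply: sumr_ge0 => k _; rewrite mulr_ge0 ?(ltW (PI0 _))// addr_ge0// sqr_ge0.
Qed.

Let gam_law k : linear_cdf P (gam Z Pw k) (Pw * Om k).
Proof.
have [re im] := nh k.
pose a : pred gidx := pred1 (inl k, false); pose b : pred gidx := pred1 (inl k, true).
have := @normal_pair_linear_cdf _ _ _ P (Z (inl k, false)) (Z (inl k, true))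
  (Om k / 2) Pw (G b) (divr_gt0 (Om0 k) (ltr0Sn _ _)) Pw0 re im (@Gm b).
rewrite [2 * _]mulrC divfK//; apply.
  apply: (@G_indep a b (Z (inl k, false))) => [j /eqP ->|].
    by rewrite /b /= xpair_eqE andbF.
  have aj : a (inl k, false) by rewrite /a/= eqxx.
  exact: (@mZ a (inl k, false) I aj).
have bj : b (inl k, true) by rewrite /b/= eqxx.
exact: (@mZ b (inl k, true) I bj).
Qed.

Let Gam_moment3 N : finite_moment3 P (Gam Z L PI N).
Proof.
apply: finite_moment3_sum => k; apply: finite_moment3Z; first exact: ltW.
have [re im] := nc (ltn_ord k).
have v0 : 0 < OmC N k / 2 by rewrite divr_gt0// OmC0.
by apply: finite_moment3D; apply: (finite_moment3_sqr_normal v0).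
Qed.

Let mGamT N : measurable_fun setT (Gam Z L PI N).
Proof. by case: (Gam_moment3 N). Qed.

(** The cube of a sum that is at least 1 dominates all first and second moments needed below, so one
    third-moment bound gives every integrability. *)
Let integrable_quadratic N M (f : T -> R) : measurable_fun setT f ->
  (forall t, 0 <= f t <= (Gam Z L PI N t + Gam Z L PI M t + 1) ^+ 3) ->
  P.-integrable setT (EFin \o f).
Proof.
move=> mf fQ.
have [mQ Q0 Qoo] : finite_moment3 P (fun t => Gam Z L PI N t + Gam Z L PI M t + 1).
  by do ![apply: finite_moment3D => //]; exact: finite_moment3_cst.
apply/integrableP; split; first exact/measurable_EFinP.
apply: le_lt_trans Qoo; apply: ge0_le_integral => //=.
- by apply/measurable_EFinP; exact: measurableT_comp.
- by apply/measurable_EFinP; exact: measurable_funX.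
- by move=> t _; rewrite lee_fin; case/andP: (fQ t) => f0 ?; rewrite ger0_norm.
Qed.

(** * One terminal: the limit in terms of interference moments *)

Section terminal.
(* [s] relabels the channels: the identity for T1, the swap of h_1, h_2 for T2. *)
Variables (s : 'I_3 -> 'I_3) (N : 'I_3) (wi wj : R).
Hypotheses (s_inj : injective s) (NR : N != nR).
Hypotheses (wi0 : 0 < wi) (wi1 : wi < 1) (wj0 : 0 < wj) (wj1 : wj < 1).

Let GT := Gam Z L PI N.
Let GR := Gam Z L PI nR.

(** The denominators of the three ratios; the power coefficient [wj] of the second hop is moved down
    here so that the numerators are the bare channel gains. *)
Let A (k : 'I_3) t := if k == h2 then (GR t + wi * GT t + wi + 1) / wj else GT t + 1.

Let EGT := Expect P GT.
Let EGT2 := Expect P (fun t => GT t ^+ 2).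
Let EGR := Expect P GR.

Let ED f g : P.-integrable setT (EFin \o f) -> P.-integrable setT (EFin \o g) ->
  Expect P (fun t => f t + g t) = Expect P f + Expect P g.
Proof. exact: RintegralD. Qed.

Let EZ c f : P.-integrable setT (EFin \o f) ->
  Expect P (fun t => c * f t) = c * Expect P f.
Proof. exact: RintegralZl. Qed.

Let E1 : Expect P (fun=> 1) = 1.
Proof.
rewrite /Expect integral_cst//= probability_setT mule1//.
Qed.

Let iT : P.-integrable setT (EFin \o GT).
Proof.
apply: (@integrable_quadratic N nR) => [|t]; first exact: mGamT.
rewrite Gam_ge0/=; apply: (@le_trans _ _ (Gam Z L PI N t + Gam Z L PI nR t + 1)).
  by rewrite -addrA lerDl addr_ge0// Gam_ge0.
by apply: ler_eXnr; rewrite // lerDr addr_ge0// Gam_ge0.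
Qed.

Let iR : P.-integrable setT (EFin \o GR).
Proof.
apply: (@integrable_quadratic N nR) => [|t]; first exact: mGamT.
rewrite Gam_ge0/=; apply: (@le_trans _ _ (Gam Z L PI N t + Gam Z L PI nR t + 1)).
  by rewrite addrAC lerDr addr_ge0// Gam_ge0.
by apply: ler_eXnr; rewrite // lerDr addr_ge0// Gam_ge0.
Qed.

Let i1 : P.-integrable setT (EFin \o (fun=> 1)).
Proof. exact: finite_measure_integrable_cst. Qed.

Let iq X Y : X \in [:: N; nR] -> Y \in [:: N; nR] ->
  P.-integrable setT (EFin \o (fun t => (Gam Z L PI X t + 1) * (Gam Z L PI Y t + 1))).
Proof.
have le M t : M \in [:: N; nR] ->
    Gam Z L PI M t + 1 <= Gam Z L PI N t + Gam Z L PI nR t + 1.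
  by rewrite !inE lerD2r => /orP[]/eqP ->; rewrite ?lerDl ?lerDr Gam_ge0.
move=> XN YN; apply: (@integrable_quadratic N nR) => [|t].
  by apply: measurable_funM; apply: measurable_funD => //; exact: mGamT.
have q1 : 1 <= Gam Z L PI N t + Gam Z L PI nR t + 1.
  by rewrite lerDr addr_ge0// Gam_ge0.
rewrite mulr_ge0 ?addr_ge0 ?Gam_ge0//=.
apply: (@le_trans _ _ ((Gam Z L PI N t + Gam Z L PI nR t + 1) ^+ 2)).
  by rewrite expr2 ler_pM ?addr_ge0 ?Gam_ge0 ?le.
by apply: ler_weXn2l.
Qed.

Let mem_N : N \in [:: N; nR]. Proof. by rewrite inE eqxx. Qed.
Let mem_R : nR \in [:: N; nR]. Proof. by rewrite !inE eqxx orbT. Qed.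

Let iT2 : P.-integrable setT (EFin \o (fun t => GT t ^+ 2)).
Proof.
apply: le_integrable (iq mem_N mem_N) => //.
  by apply/measurable_EFinP; apply: measurable_funX; exact: mGamT.
move=> t _; rewrite /= lee_fin expr2 !ger0_norm ?mulr_ge0 ?addr_ge0 ?Gam_ge0//.
by rewrite ler_pM ?Gam_ge0 ?lerDl.
Qed.

Let expect_A1 : Expect P (fun t => (GT t + 1) * (GT t + 1)) = EGT2 + 2 * EGT + 1.
Proof.
have i2T : P.-integrable setT (EFin \o (fun t => 2 * GT t)).
  by apply: eq_integrable (integrableZl _ 2 iT).
have i2T1 : P.-integrable setT (EFin \o (fun t => 2 * GT t + 1)).
  by apply: eq_integrable (integrableD _ i2T i1).
rewrite (_ : (fun t => _) = fun t => GT t ^+ 2 + (2 * GT t + 1)); last first.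
  by apply/funext => t; ring.
by rewrite ED// ED// EZ// E1 addrA.
Qed.

(** [N != nR] makes the selections [node nR] and [node N] disjoint, so the two interference powers
    are independent. *)
Let expect_GRGT : Expect P (fun t => (GR t + 1) * (GT t + 1)) = (EGR + 1) * (EGT + 1).
Proof.
have iT1 : P.-integrable setT (EFin \o (fun t => GT t + 1)).
  by apply: eq_integrable (integrableD _ iT i1).
have iR1 : P.-integrable setT (EFin \o (fun t => GR t + 1)).
  by apply: eq_integrable (integrableD _ iR i1).
rewrite (@expectM_indep _ _ _ P (fun t => GR t + 1) (fun t => GT t + 1) (G (node N))).
- by rewrite !ED// E1.
- exact: Gm.
- apply: (@G_indep (node nR)) => [[[i|[M k]] b]//|].
    by rewrite /node/= => /eqP ->; rewrite eq_sym.
  by apply: measurable_funD => //; apply: mGam => k b; rewrite /node/= eqxx.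
- by apply: measurable_funD => //; exact: mGamT.
- by apply: measurable_funD => //; apply: mGam => k b; rewrite /node/= eqxx.
- by move=> t; rewrite addr_ge0// Gam_ge0.
- by move=> t; rewrite addr_ge0// Gam_ge0.
- exact: integrable_lty iR1.
- exact: integrable_lty iT1.
Qed.

(** The relay denominator splits as wi (Gamma_T + 1) + (Gamma_R + 1); multiplied by Gamma_T + 1 it
    gives a pure square and a product of independent factors. *)
Let expect_A2 : Expect P (fun t => (GR t + wi * GT t + wi + 1) / wj * (GT t + 1)) =
  (wi * (EGT2 + 2 * EGT + 1) + (EGR + 1) * (EGT + 1)) / wj.
Proof.
rewrite (_ : (fun t => _) = fun t => wj^-1 *
  (wi * ((GT t + 1) * (GT t + 1)) + (GR t + 1) * (GT t + 1))); last first.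
  by apply/funext => t; ring.
have iw : P.-integrable setT (EFin \o (fun t => wi * ((GT t + 1) * (GT t + 1)))).
  by apply: eq_integrable (integrableZl _ wi (iq mem_N mem_N)).
have iRT := iq mem_R mem_N.
rewrite EZ; last by apply: eq_integrable (integrableD _ iw iRT).
rewrite ED// EZ; last exact: iq.
by rewrite expect_A1 expect_GRGT [LHS]mulrC.
Qed.

Lemma terminal_outage_cvg :
  (Prob_lt P (fun t => Ups (gam Z Pw (s h0) t) (gam Z Pw (s h1) t)
     (gam Z Pw (s h2) t) (GT t) (GR t) wi wj) g / g ^+ 2) @[g --> 0^'+] -->
  asym_term 1 (Pw * Om (s h0)) (Pw * Om (s h1)) (Pw * Om (s h2)) wi wj EGT EGT2 EGR.
Proof.
(* The factor 2 covers the constant wi + 1 <= 2, and 1/wj >= 1 lets the same envelope dominate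
   Gamma_T + 1. *)
pose Q t := 2 / wj * (GT t + GR t + 1).
have GT0 t : 0 <= GT t by exact: Gam_ge0.
have GR0 t : 0 <= GR t by exact: Gam_ge0.
have A0 k t : 0 < A k t.
  rewrite /A; case: ifP => _; last by rewrite ltr_wpDl.
  by rewrite divr_gt0// ltr_wpDl// !addr_ge0// ?mulr_ge0// ltW.
have AQ k t : A k t <= Q t.
  rewrite /A /Q [2 / wj * _]mulrAC; case: ifP => _.
    rewrite ler_pM2r ?invr_gt0//; move: (GT t) (GR t) (GT0 t) (GR0 t) => a b a0 b0.
    have : wi * a <= a by rewrite ler_piMl// ltW.
    by move=> wa; have := wi1; lra.
  rewrite ler_pdivlMr//; move: (GT t) (GR t) (GT0 t) (GR0 t) => a b a0 b0.
  by apply: (@le_trans _ _ (a + 1)); [rewrite ler_piMr ?addr_ge0// ltW|lra].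
have Qm : finite_moment3 P Q.
  apply: finite_moment3Z; first by rewrite divr_ge0// ltW.
  apply: finite_moment3D; last exact: finite_moment3_cst.
  by apply: finite_moment3D; exact: Gam_moment3.
have [mQ _ Q3] := Qm.
(* Everything except the two components of one channel: all interference terms and the two other
   channels are measurable for it. *)
pose H k := G (predC (channel (s k))).
have mGT k : measurable_fun [set: g_sigma_algebraType (H k)] GT by exact: mGam.
have mGR k : measurable_fun [set: g_sigma_algebraType (H k)] GR by exact: mGam.
have mAH k l : measurable_fun [set: g_sigma_algebraType (H k)] (A l).
  rewrite /A; case: (l == h2); last exact: measurable_funD.
  apply: measurable_funM => //; apply: measurable_funD => //.
  apply: measurable_funD => //; apply: measurable_funD => //.
  exact: measurable_funM.
have UH k : indep_from P (gam Z Pw (s k)) (H k).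
  apply: (@G_indep (channel (s k))) => [j cj|]; first by rewrite /= cj.
  by apply: mgam => b; rewrite /channel/=.
have mUH k l : k != l -> measurable_fun [set: g_sigma_algebraType (H k)] (gam Z Pw (s l)).
  move=> kl; apply: mgam => b; rewrite /channel/= (inj_eq s_inj) eq_sym.
  by rewrite kl.
have mU k : measurable_fun setT (gam Z Pw (s k)).
  by apply: (measurable_sub_sigma (@Gm predT)); exact: mgam.
have m0 k : 0 < Pw * Om (s k) by rewrite mulr_gt0.
have := outage_cvg P (fun k => gam Z Pw (s k)) (fun k => Pw * Om (s k)) H A Q
  m0 (fun k t => gam_ge0 (s k) t) mU (fun k => @Gm _) UH (fun k => gam_law (s k))
  mUH mAH A0 AQ mQ Q3.
rewrite [X in _ --> X -> _](_ : _ =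
  asym_term 1 (Pw * Om (s h0)) (Pw * Om (s h1)) (Pw * Om (s h2)) wi wj EGT EGT2 EGR); last first.
  rewrite /= expect_A1 expect_A2 /asym_term; field.
  by rewrite !gt_eqF.
apply: cvg_trans; apply: near_eq_cvg; apply: nearW => g /=.
congr (Prob_lt P _ g / _); apply/funext => t.
rewrite /Ups /UpsD /Ups1 /Ups2 /A/=.
have wjE x y : x / (y / wj) = wj * x / y by rewrite invf_div mulrA [x * wj]mulrC.
by rewrite !wjE.
Qed.

End terminal.
End relay_model.

Theorem theorem2 (R : realType) (d : measure_display) (T : measurableType d)
  (P : probability T R)
  (Pw : R) (Om : 'I_3 -> R) (L : 'I_3 -> nat) (PI : 'I_3 -> R)
  (OmC : 'I_3 -> nat -> R) (w1 w2 : R)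
  (Z : gidx -> {RV P >-> R}) :
  0 < Pw ->
  (forall i, 0 < Om i) ->
  (forall N, (1 <= L N)%N) ->
  (forall N, 0 < PI N) ->
  (forall N k, (k < L N)%N -> 0 < OmC N k) ->
  0 < w1 < 1 -> 0 < w2 < 1 -> w1 + w2 = 1 ->
  (forall i, is_CN0 (Z (inl i, false)) (Z (inl i, true)) (Om i)) ->
  (forall N k, (k < L N)%N ->
     is_CN0 (Z (inr (N, k), false)) (Z (inr (N, k), true)) (OmC N k)) ->
  mutually_independent (relevant L) Z ->
  let g0 := gam Z Pw h0 in
  let g1 := gam Z Pw h1 in
  let g2 := gam Z Pw h2 in
  let GT1 := Gam Z L PI nT1 in
  let GT2 := Gam Z L PI nT2 in
  let GR := Gam Z L PI nR in
  let G1 N := Expect P (Gam Z L PI N) in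
  let G2 N := Expect P (fun t => Gam Z L PI N t ^+ 2) in
  let gb i := Pw * Om i in
  let PT1 g := Prob_lt P (fun t => Ups (g0 t) (g1 t) (g2 t) (GT1 t) (GR t) w1 w2) g in
  let PT2 g := Prob_lt P (fun t => Ups (g0 t) (g2 t) (g1 t) (GT2 t) (GR t) w2 w1) g in
  let main g :=
    asym_term g (gb h0) (gb h1) (gb h2) w1 w2 (G1 nT1) (G2 nT1) (G1 nR) +
    asym_term g (gb h0) (gb h2) (gb h1) w2 w1 (G1 nT2) (G2 nT2) (G1 nR) in
  (fun g => (Ppro (PT1 g) (PT2 g) - main g) / g ^+ 2) @ 0^'+ --> 0.
Proof.
move=> Pw0 Om0 _ PI0 OmC0 /andP[w10 w11] /andP[w20 w21] _ nh nc indZ.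
move=> g0 g1 g2 GT1 GT2 GR G1 G2 gb PT1 PT2 main.
have c1 : PT1 g / g ^+ 2 @[g --> 0^'+] -->
    asym_term 1 (gb h0) (gb h1) (gb h2) w1 w2 (G1 nT1) (G2 nT1) (G1 nR).
  exact: (@terminal_outage_cvg _ _ _ P Pw Om L PI OmC Z Pw0 Om0 PI0 OmC0 nh nc
    indZ id nT1 w1 w2 (@inj_id _) isT w10 w11 w20 w21).
have c2 : PT2 g / g ^+ 2 @[g --> 0^'+] -->
    asym_term 1 (gb h0) (gb h2) (gb h1) w2 w1 (G1 nT2) (G2 nT2) (G1 nR).
  (* The second terminal sees the same network with the channels [h1] and [h2] exchanged; the
     exchange is its own inverse. *)
  pose s (k : 'I_3) := if k == h1 then h2 else if k == h2 then h1 else k.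
  have s_inj : injective s.
    by apply: (can_inj (g := s)) => -[[|[|[|//]]] k]; apply/val_inj.
  exact: (@terminal_outage_cvg _ _ _ P Pw Om L PI OmC Z Pw0 Om0 PI0 OmC0 nh nc
    indZ s nT2 w2 w1 s_inj isT w20 w21 w10 w11).
set k1 := asym_term 1 _ _ _ _ _ _ _ _ in c1; set k2 := asym_term 1 _ _ _ _ _ _ _ _ in c2.
have mainE g : main g = g ^+ 2 * (k1 + k2).
  by rewrite /main /k1 /k2 /asym_term; ring.
have id0 : (fun g : R => g) @ 0^'+ --> (0 : R) by exact: cvg_at_right_filter.
(* The product term is rewritten with each probability divided by g^2, leaving an explicit factor
   g^2 that tends to 0 against bounded ratios. *)
have : (fun g => (PT1 g / g ^+ 2 + PT2 g / g ^+ 2 -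
    (PT1 g / g ^+ 2) * (PT2 g / g ^+ 2) * (g * g)) - (k1 + k2)) @ 0^'+ -->
    (k1 + k2 - k1 * k2 * (0 * 0)) - (k1 + k2).
  apply: cvgB; last exact: cvg_cst.
  apply: cvgB; first exact: cvgD.
  by apply: cvgM; [exact: cvgM|exact: cvgM].
rewrite mul0r mulr0 subr0 subrr; apply: cvg_trans; apply: near_eq_cvg.
near=> g.
have g0' : g != 0 by apply: lt0r_neq0; near: g; exact: nbhs_right_gt.
by rewrite mainE /Ppro; field.
Unshelve. all: by end_near. Qed.
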